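(* Let $G$ be a second countable locally compact abelian group, let $v$ be a weight on $G\times\widehat{G}$, let $\Lambda$ be a lattice in $G\times\widehat{G}$, and let $f:[0,\infty)\to[0,\infty)$ be a spectral triple compatible function for $v$ with respect to $\Lambda$. Let $c$ be the Heisenberg $2$-cocycle and let $D$ be the (unbounded) selfadjoint operator on $\ell^2(\Lambda)\oplus\ell^2(\Lambda)$ given by $$D=\begin{pmatrix}f(v)&0\\ 0&f(v)\end{pmatrix},$$ where $f(v)$ acts by multiplication by the function $\lambda\mapsto f(v(\lambda))$. Then $(\ell^1_{v^n}(\Lambda,c),\ \ell^2(\Lambda)\oplus\ell^2(\Lambda),\ D)$ is a spectral triple for $C^*(\Lambda,c)$ whenever $n\ge 1$, and $\ell^1_{v^n}(\Lambda,c)\subset QC^*(\Lambda,c)_k$ for $n\geq k+1$. In other words, if $n\ge k+1$ then the spectral triple is quantum $C^k$. Here $n,k\in\mathbb{N}$.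
   Context: Lattice: a discrete cocompact subgroup. $\widehat G$ is the Pontryagin dual of $G$. Weight: a function $v:G\times\widehat{G}\to[0,\infty)$ with $v(0)\neq 0$ such that (i) $v(\xi+\chi)\le v(\xi)v(\chi)$ for all $\xi,\chi$; (ii) there are $C,s>0$ with $v(\xi)\le C(1+d(\xi,0))^s$ for all $\xi$, where $d$ is a translation-invariant metric generating the topology of $G\times\widehat G$; (iii) $v(\xi)=v(-\xi)$ for all $\xi$. Spectral triple compatible: $f:[0,\infty)\to[0,\infty)$ is spectral triple compatible for $v$ with respect to $\Lambda$ if there are constants $C_{\mathrm{dif}},C_{\mathrm{sm}},C_{\mathrm{gr}}\in[0,\infty)$ such that for all $\lambda,\mu\in\Lambda$: $|f(v(\lambda+\mu))-f(v(\lambda))|\le C_{\mathrm{dif}}f(v(\mu))$; $f(v(\lambda+\mu))\le C_{\mathrm{sm}}f(v(\lambda))f(v(\mu))$; $f(v(\lambda))\le C_{\mathrm{gr}}v(\lambda)$. Heisenberg $2$-cocycle: $c((x_1,\omega_1),(x_2,\omega_2))=\overline{\omega_2(x_1)}$. For a weight $w$, $\ell^1_w(\Lambda,c)$ is $\{a\in\ell^1(\Lambda): \sum_{\lambda}|a(\lambda)|w(\lambda)<\infty\}$ with twisted convolution $(a_1*_c a_2)(\lambda)=\sum_{\lambda'\in\Lambda}a_1(\lambda')a_2(\lambda-\lambda')c(\lambda',\lambda-\lambda')$ and involution $a^*(\lambda)=c(\lambda,\lambda)\overline{a(-\lambda)}$; $\ell^1(\Lambda,c)$ is the case $w=1$.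 $C^*(\Lambda,c)$ is the twisted group $C^*$-algebra, i.e. the $C^*$-completion of $\ell^1(\Lambda,c)$ (full and reduced completions agree as $\Lambda$ is abelian). $C^*(\Lambda,c)$ acts on $\ell^2(\Lambda)$ by the continuous extension of left twisted convolution, and diagonally on $\ell^2(\Lambda)\oplus\ell^2(\Lambda)$. The domain of $D$ is $\{(b,b')^T: f(v)b,\ f(v)b'\in\ell^2(\Lambda)\}$. Spectral triple for a $C^*$-algebra $A$: a triple $(\mathcal A,\mathcal H,D)$ with $\mathcal A\subset A$ a dense $*$-subalgebra, $\mathcal H$ a Hilbert space on which $A$ is represented, and $D$ a densely defined selfadjoint operator on $\mathcal H$, such that for every $a\in\mathcal A$: $a\,\mathrm{Dom}(D)\subset\mathrm{Dom}(D)$, $[D,a]$ extends to a bounded operator, and $a(1+D^2)^{-1/2}$ is compact. Quantum $C^k$: $\mathrm{ad}^j(|D|)(T)$ denotes the $j$ times iterated commutator $[|D|,[|D|,\dots,[|D|,T]\dots]]$, and $T$ lies in the domain of $\mathrm{ad}^k(|D|)$ if the iterated commutators up to order $k$ are defined and extend to bounded operators. $QA_k:=\{a\in\mathcal A: a \text{ and } [D,a] \text{ are both in } \mathrm{Dom}(\mathrm{ad}^k(|D|))\}$; for $A=C^*(\Lambda,c)$ this is written $QC^*(\Lambda,c)_k$. The spectral triple is quantum $C^k$ ($QC^k$) if for all $a\in\mathcal A$ both $a$ and $[D,a]$ are in the domain of $\mathrm{ad}^k(|D|)$.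
   Formalization: Compactness of a(1+D²)^{-1/2} is false in general (v=1, f=0 gives D=0); it is claimed only when f(v(λ)) tends to infinity along Λ (each set {f(v(λ)) ≤ M} finite), which is necessary as the algebra is unital. All other clauses hold without this assumption. *)

(* Defs.v *)
From HB Require Import structures.
From mathcomp Require Import all_boot all_order all_algebra.
From mathcomp Require Import all_classical all_reals all_analysis.
From mathcomp Require Import complex finmap ring.
From mathcomp Require summability.

Set Implicit Arguments.
Unset Strict Implicit.
Unset Printing Implicit Defensive.

Import Order.TTheory GRing.Theory Num.Theory.
Import numFieldNormedType.Exports.

Local Open Scope classical_set_scope.
Local Open Scope ring_scope.

HB.mixin Record isHilbert (C : numClosedFieldType) H
    & CompleteNormedModule C H := {
  hdot : H -> H -> C ;
  hdotP : forall a x y z, hdot (a *: x + y) z = a * hdot x z + hdot y z ;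
  hdotC : forall x y, hdot y x = (hdot x y)^* ;
  hdotE : forall x, hdot x x = `|x| ^+ 2 }.

#[short(type="hilbertType")]
HB.structure Definition Hilbert (C : numClosedFieldType) :=
  {H of CompleteNormedModule C H & isHilbert C H}.

Section PreHilbert.
Variables (C : numClosedFieldType) (U : lmodType C) (dot : U -> U -> C).
Hypothesis dotP : forall a x y z, dot (a *: x + y) z = a * dot x z + dot y z.
Hypothesis dotC : forall x y, dot y x = (dot x y)^*.
Hypothesis dot_ge0 : forall x, 0 <= dot x x.
Hypothesis dot_eq0 : forall x, dot x x = 0 -> x = 0.

Let dot0l z : dot 0 z = 0.
Proof. by have := dotP 1 0 0 z; rewrite scale1r addr0 mul1r -[LHS]addr0 => /addrI/esym. Qed.
Let dotDl x y z : dot (x + y) z = dot x z + dot y z.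
Proof. by rewrite -[x]scale1r dotP mul1r scale1r. Qed.
Let dotZl a x z : dot (a *: x) z = a * dot x z.
Proof. by rewrite -[a *: x]addr0 dotP dot0l addr0. Qed.
Let dotDr x y z : dot z (x + y) = dot z x + dot z y.
Proof. by rewrite dotC dotDl rmorphD /= -!dotC. Qed.
Let dotZr a x z : dot z (a *: x) = a^* * dot z x.
Proof. by rewrite dotC dotZl rmorphM /= -dotC. Qed.

Lemma dot_cauchy_schwarz x y : `|dot x y| ^+ 2 <= dot x x * dot y y.
Proof.
have [y0|y0] := eqVneq (dot y y) 0.
  by rewrite (dot_eq0 y0) [dot x 0]dotC !dot0l conjC0 normr0 expr0n mulr0.
have ygt0 : 0 < dot y y by rewrite lt_def y0 dot_ge0.
have := dot_ge0 (dot y y *: x - dot x y *: y).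
rewrite -scaleNr !(dotDl, dotDr, dotZl, dotZr).
rewrite (dotC x y) !rmorphN /= (geC0_conj (dot_ge0 y)).
set a := dot x x; set b := dot y y; set c := dot x y => H.
have : 0 <= b * (a * b - `|c| ^+ 2).
  by apply: (le_trans H); rewrite normCK le_eqVlt; apply/orP; left; apply/eqP; ring.
by rewrite pmulr_rge0// subr_ge0.
Qed.

Lemma sqrt_dotD x y :
  sqrtC (dot (x + y) (x + y)) <= sqrtC (dot x x) + sqrtC (dot y y).
Proof.
have sx : 0 <= sqrtC (dot x x) by rewrite sqrtC_ge0.
have sy : 0 <= sqrtC (dot y y) by rewrite sqrtC_ge0.
rewrite -(@ler_pXn2r _ 2)// ?nnegrE ?addr_ge0// ?sqrtC_ge0//.
rewrite sqrtCK sqrrD !sqrtCK !(dotDl, dotDr) (dotC x y).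
set a := dot x x; set b := dot y y; set c := dot x y.
have -> : a + c + (c^* + b) = a + (c + c^*) + b by ring.
rewrite lerD2r lerD2l.
have -> : c + c^* = 'Re c *+ 2.
  by rewrite [in RHS]ReE -mulr_natr mulfVK ?pnatr_eq0.
rewrite lerMn2r /=; apply: le_trans (real_ler_norm (Creal_Re _)) _.
apply: le_trans (leif_normC_Re_Creal _) _.
rewrite -(@ler_pXn2r _ 2)// ?nnegrE ?mulr_ge0// exprMn !sqrtCK.
exact: dot_cauchy_schwarz.
Qed.
End PreHilbert.

Definition cabs (R : rcfType) (z : R[i]) : R := complex.Re `|z|.

Section ComplexAnalysis.
Variable R : realType.
Implicit Types z w : R[i].

Lemma cabsE z : `|z| = (cabs z)%:C%C.
Proof. by rewrite /cabs normc_def. Qed.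

Lemma cabs_ge0 z : 0 <= cabs z.
Proof. by rewrite /cabs normc_def /= sqrtr_ge0. Qed.

Lemma cabsN z : cabs (- z) = cabs z.
Proof. by rewrite /cabs normrN. Qed.

Lemma cabsM z w : cabs (z * w) = cabs z * cabs w.
Proof. by apply: complexI; rewrite rmorphM /= -!cabsE normrM. Qed.

Lemma cabs_conj z : cabs z^* = cabs z.
Proof. by rewrite /cabs norm_conjC. Qed.

Lemma cabsD z w : cabs (z + w) <= cabs z + cabs w.
Proof. by rewrite -lecR rmorphD /= -!cabsE ler_normD. Qed.

Lemma cabs_eq0 z : cabs z = 0 -> z = 0.
Proof. by move=> z0; apply/eqP; rewrite -normr_eq0 cabsE z0. Qed.

Lemma Re_le_cabs z : `|complex.Re z| <= cabs z.
Proof.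
rewrite /cabs normc_def /= -sqrtr_sqr ler_sqrt ?addr_ge0 ?sqr_ge0//.
by rewrite lerDl sqr_ge0.
Qed.

Lemma Im_le_cabs z : `|complex.Im z| <= cabs z.
Proof.
rewrite /cabs normc_def /= -sqrtr_sqr ler_sqrt ?addr_ge0 ?sqr_ge0//.
by rewrite lerDr sqr_ge0.
Qed.

Lemma cabs_le_ReIm z : cabs z <= `|complex.Re z| + `|complex.Im z|.
Proof.
case: z => a b; rewrite /cabs normc_def /=.
rewrite -(@ler_pXn2r _ 2)// ?nnegrE ?addr_ge0 ?sqrtr_ge0//.
rewrite sqr_sqrtr ?addr_ge0 ?sqr_ge0// sqrrD !real_normK ?num_real//.
by rewrite lerD2r lerDl mulrn_wge0// mulr_ge0.
Qed.

Lemma gtc0P (e : R[i]) : 0 < e -> exists2 r : R, 0 < r & e = r%:C%C.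
Proof.
case: e => a b; rewrite ltcE /= => /andP[/eqP -> a0]; by exists a.
Qed.

Lemma cvg_complex T (F : set_system T) (FF : Filter F) (u : T -> R[i]^o)
    (l : R[i]^o) :
  (fun x => complex.Re (u x)) @ F --> complex.Re l ->
  (fun x => complex.Im (u x)) @ F --> complex.Im l -> u @ F --> l.
Proof.
move=> /cvgrPdist_lt cR /cvgrPdist_lt cI; apply/cvgrPdist_lt => e /gtc0P[r r0 ->].
have r20 : 0 < r / 2 by rewrite divr_gt0.
have {}cR := cR _ r20; have {}cI := cI _ r20.
near=> x.
rewrite cabsE ltcR (le_lt_trans (cabs_le_ReIm _))// [ltRHS](splitr r) ltrD//.
  have : `|complex.Re l - complex.Re (u x)| < r / 2 by near: x.
  by case: (l) => ? ?; case: (u x).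
have : `|complex.Im l - complex.Im (u x)| < r / 2 by near: x.
by case: (l) => ? ?; case: (u x).
Unshelve. all: by end_near. Qed.

Lemma complex_complete (F : set_system R[i]^o) :
  ProperFilter F -> cauchy F -> exists l : R[i]^o, F --> l.
Proof.
move=> FF /cauchyP Fc.
have cau (h : R[i]^o -> R) : (forall z w, `|h z - h w| <= cabs (z - w)) ->
    cvg (h @ F).
  move=> hE; apply: cauchy_cvg; apply: cauchy_exP => e e0.
  have [|x Fx] := Fc e%:C%C; first by rewrite ltcR.
  exists (h x); suff : F (h @^-1` ball (h x) e) by [].
  apply: filterS Fx => y; rewrite /preimage /= -!ball_normE /=.
  change (`|(x : R[i]) - y| < e%:C%C -> `|h x - h y| < e); rewrite cabsE ltcR.
  exact: le_lt_trans (hE _ _).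
have /cvg_ex[a Fa] : cvg ((@complex.Re R : R[i]^o -> R) @ F).
  by apply: cau => -[a b] [c d]; exact: (Re_le_cabs ((a +i* b) - (c +i* d))%C).
have /cvg_ex[b Fb] : cvg ((@complex.Im R : R[i]^o -> R) @ F).
  by apply: cau => -[a1 b] [c d]; exact: (Im_le_cabs ((a1 +i* b) - (c +i* d))%C).
exists (a +i* b)%C.
exact: (@cvg_complex _ F _ (fun x => x) (a +i* b)%C Fa Fb).
Qed.

End ComplexAnalysis.

#[global] Instance totally_proper (I : choiceType) :
  ProperFilter (@summability.totally I).
Proof. exact: summability.totally_filter. Qed.

Section Nets.
Variables (R : realType) (I : choiceType).

Lemma partial_sumE (V : zmodType) (x : I -> V) A :
  summability.partial_sum x A = \sum_(i <- A) x i.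
Proof. by rewrite /summability.partial_sum big_seq_fsetE. Qed.

Lemma totallyS (A : {fset I}) :
  summability.totally [set B : {fset I} | (A `<=` B)%fset].
Proof. by exists A. Qed.

Lemma ler_sum_fsubset (u : I -> R) (A B : {fset I}) : (forall i, 0 <= u i) ->
  (A `<=` B)%fset -> \sum_(i <- A) u i <= \sum_(i <- B) u i.
Proof.
move=> u0 /fsubsetP AB; rewrite [leRHS](bigID (mem A)) /=.
have -> : \sum_(i <- A) u i = \sum_(i <- B | i \in A) u i.
  rewrite -[RHS]big_filter; apply: perm_big; apply: uniq_perm.
  - exact: fset_uniq.
  - by rewrite filter_uniq// fset_uniq.
  by move=> i; rewrite mem_filter; case: (boolP (i \in A)) => // /AB ->.
by rewrite lerDl sumr_ge0.
Qed.

Let ge0_cvg (u : I -> R) (M : R) : (forall i, 0 <= u i) ->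
  (forall A : {fset I}, \sum_(i <- A) u i <= M) ->
  cvg (summability.partial_sum u @ summability.totally).
Proof.
move=> u0 uM; set S := [set \sum_(i <- A) u i | A in [set: {fset I}]].
have supS : has_sup S.
  split; first by exists (\sum_(i <- fset0) u i); exists fset0.
  by exists M => _ [A _ <-].
apply/cvg_ex; exists (sup S); apply/cvgrPdist_lt => e e0.
have [_ [A _ <-] SA] := sup_adherent e0 supS.
apply: filterS (totallyS A) => B /= AB; rewrite partial_sumE.
have BS : \sum_(i <- B) u i <= sup S by apply: sup_upper_bound => //; exists B.
rewrite ger0_norm ?subr_ge0// ltrBlDl -ltrBlDr (lt_le_trans SA)//.
exact: ler_sum_fsubset.
Qed.

Lemma abs_cvg (u : I -> R[i]^o) (M : R) :
  (forall A : {fset I}, \sum_(i <- A) cabs (u i) <= M) ->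
  cvg (summability.partial_sum u @ summability.totally).
Proof.
move=> uM.
have cvgr (h : R[i] -> R) : (forall z, `|h z| <= cabs z) ->
    cvg (summability.partial_sum (h \o u) @ summability.totally).
  move=> hE.
  have -> : summability.partial_sum (h \o u) = summability.partial_sum
     (fun i => Num.max (h (u i)) 0) \- summability.partial_sum
     (fun i => Num.max (- h (u i)) 0).
    apply/funext => A /=; rewrite !partial_sumE -sumrB; apply: eq_bigr => i _ /=.
    rewrite /Order.max oppr_lt0; case: (ltrgt0P (h (u i))) => h0.
    - by rewrite subr0.
    - by rewrite sub0r opprK.
    by rewrite ?h0 !oppr0 ?addr0.
  apply: is_cvgB.
    apply: (@ge0_cvg _ M) => [i|A]; first by rewrite le_max lexx orbT.
    apply: le_trans (uM A); apply: ler_sum => i _.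
    by rewrite ge_max cabs_ge0 andbT (le_trans (ler_norm _) (hE _)).
  apply: (@ge0_cvg _ M) => [i|A]; first by rewrite le_max lexx orbT.
  apply: le_trans (uM A); apply: ler_sum => i _.
  by rewrite ge_max cabs_ge0 andbT (le_trans (ler_norm _))// normrN.
have /cvg_ex[a ua] := cvgr _ (@Re_le_cabs R).
have /cvg_ex[b ub] := cvgr _ (@Im_le_cabs R).
apply/cvg_ex; exists (a +i* b)%C; apply: cvg_complex.
  rewrite /=; apply: cvg_trans ua; apply: near_eq_cvg; apply: nearW => A.
  rewrite !partial_sumE /=.
  by rewrite (big_morph (@complex.Re R) (id1 := 0) (op1 := +%R)) // => -[? ?] [].
rewrite /=; apply: cvg_trans ub; apply: near_eq_cvg; apply: nearW => A.
rewrite !partial_sumE /=.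
by rewrite (big_morph (@complex.Im R) (id1 := 0) (op1 := +%R)) // => -[? ?] [].
Qed.

End Nets.

Section Esum.
Variables (R : realType) (I : choiceType).

Lemma esum_ltP (u : I -> R) : (forall i, 0 <= u i) ->
  (\esum_(i in [set: I]) (u i)%:E < +oo)%E <->
  exists M, forall A : {fset I}, \sum_(i <- A) u i <= M.
Proof.
move=> u0; split=> [uoo|[M uM]].
  have e0 : (0 <= \esum_(i in [set: I]) (u i)%:E)%E.
    by apply: esum_ge0 => i _; rewrite lee_fin.
  exists (fine (\esum_(i in [set: I]) (u i)%:E)) => A.
  rewrite -lee_fin fineK ?ge0_fin_numE// -sumEFin; apply: esum_ge.
  exists [set` A] => //; rewrite (fsbig_seq _ (fun i => (u i)%:E)) ?fset_uniq//.
apply: (@le_lt_trans _ _ M%:E); last exact: ltry.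
apply: ub_ereal_sup => _ [A [finA _] <-].
by rewrite fsbig_finite//= sumEFin lee_fin.
Qed.

End Esum.

Section Ell2.
Variables (R : realType) (I : choiceType).
Implicit Types x y : I -> R[i]^o.

Definition sqsummable x :=
  (\esum_(i in [set: I]) (cabs (x i) ^+ 2)%:E < +oo)%E.

Lemma sqsummableP x : sqsummable x <->
  exists M, forall A : {fset I}, \sum_(i <- A) cabs (x i) ^+ 2 <= M.
Proof. by apply: esum_ltP => i; rewrite sqr_ge0. Qed.

Definition ell2_pred : {pred I -> R[i]^o} := fun x => `[< sqsummable x >].

Fact ell2_pred_submod : submod_closed ell2_pred.
Proof.
split=> [|a x y /asboolP/sqsummableP[M xM] /asboolP/sqsummableP[N yN]].
  apply/asboolP/sqsummableP; exists 0 => A; rewrite big1// => i _.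
  by rewrite (_ : _ i = 0)// /cabs normr0 expr0n.
apply/asboolP/sqsummableP; exists ((cabs a ^+ 2 * M + N) *+ 2) => A.
apply: (@le_trans _ _ (\sum_(i <- A)
    (cabs a ^+ 2 * cabs (x i) ^+ 2 + cabs (y i) ^+ 2) *+ 2)).
  apply: ler_sum => i _.
  have -> : (a *: x + y) i = a * x i + y i by [].
  apply: (@le_trans _ _ ((cabs a * cabs (x i) + cabs (y i)) ^+ 2)).
    rewrite ler_pXn2r// ?nnegrE ?addr_ge0 ?mulr_ge0 ?cabs_ge0//.
    by rewrite -cabsM cabsD.
  rewrite -exprMn.
  set p := cabs a * _; set q := cabs _.
  rewrite -subr_ge0 (_ : _ - _ = (p - q) ^+ 2) ?sqr_ge0//; ring.
rewrite sumrMnl lerMn2r /= big_split /= -mulr_sumr lerD//.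
by rewrite ler_wpM2l ?sqr_ge0.
Qed.

HB.instance Definition _ := GRing.isSubmodClosed.Build R[i] (I -> R[i]^o)
  ell2_pred ell2_pred_submod.

Record ell2 := Ell2 { ell2_val :> I -> R[i]^o ; ell2_valP : ell2_val \in ell2_pred }.

HB.instance Definition _ := [isSub for ell2_val].
HB.instance Definition _ := [Choice of ell2 by <:].
HB.instance Definition _ := [SubChoice_isSubLmodule of ell2 by <:].

Implicit Types b : ell2.

Lemma ell2P b : sqsummable b.
Proof. by case: b => x /= /asboolP. Qed.

Lemma ell2_inj b b' : (b : I -> R[i]^o) =1 b' -> b = b'.
Proof. by move=> bb'; apply: val_inj; apply/funext. Qed.

Definition ell2_dot b b' : R[i] :=
  summability.sum (fun i => b i * (b' i)^* : R[i]^o).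

Lemma ell2_dot_cvg b b' :
  summability.partial_sum (fun i => b i * (b' i)^* : R[i]^o)
    @ summability.totally --> (ell2_dot b b' : R[i]^o).
Proof.
have /sqsummableP[M bM] := ell2P b; have /sqsummableP[N bN] := ell2P b'.
apply: (@abs_cvg _ _ _ (M + N)) => A.
apply: le_trans (lerD (bM A) (bN A)); rewrite -big_split /=; apply: ler_sum => i _.
rewrite cabsM cabs_conj; set p := cabs (b i); set q := cabs _.
have p0 : 0 <= p by exact: cabs_ge0.
have q0 : 0 <= q by exact: cabs_ge0.
rewrite -subr_ge0 (_ : _ - _ = (p - q) ^+ 2 + p * q); last by ring.
by rewrite addr_ge0 ?sqr_ge0 ?mulr_ge0.
Qed.

Let ps_sum (u : I -> R[i]^o) A :
  summability.partial_sum u A = \sum_(i <- A) u i.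
Proof. exact: partial_sumE. Qed.

Let cvgU (u : {fset I} -> R[i]^o) (l l' : R[i]) :
  u @ summability.totally --> (l : R[i]^o) ->
  u @ summability.totally --> (l' : R[i]^o) -> l = l'.
Proof. by move=> /cvg_lim <-// /cvg_lim <-. Qed.

Lemma ell2_dotP a b1 b2 b' :
  ell2_dot (a *: b1 + b2) b' = a * ell2_dot b1 b' + ell2_dot b2 b'.
Proof.
apply: (cvgU (@ell2_dot_cvg (a *: b1 + b2) b')).
have := cvgD (cvgZl_tmp (k := a) (@ell2_dot_cvg b1 b')) (@ell2_dot_cvg b2 b').
move=> /(_ _ _) H; refine (cvg_trans _ H); apply: near_eq_cvg; apply: nearW => A.
rewrite [RHS]ps_sum -[LHS]/(a * summability.partial_sum _ A + summability.partial_sum _ A) !ps_sum.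
rewrite mulr_sumr -big_split /=; apply: eq_bigr => i _.
by rewrite -[LHS]/(a * (b1 i * (b' i)^*) + b2 i * (b' i)^*) mulrA -mulrDl.
Qed.

Lemma ell2_dotC b b' : ell2_dot b' b = (ell2_dot b b')^*.
Proof.
apply: (cvgU (@ell2_dot_cvg b' b)).
have /cvgrPdist_lt dc := @ell2_dot_cvg b b'; apply/cvgrPdist_lt => e /dc.
apply: filterS => A; rewrite !ps_sum.
set l := ell2_dot b b'; set s := \sum_(i <- A) (b i * _).
have -> : \sum_(i <- A) (b' i * (b i)^* : R[i]^o) = s^*.
  rewrite /s rmorph_sum; apply: eq_bigr => i _.
  by rewrite rmorphM /= conjCK mulrC.
by move=> H; rewrite -[X in X < _]/(`|l^* - s^*|) -rmorphB norm_conjC.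
Qed.

Let Re_ps b A :
  summability.partial_sum (fun i => b i * (b i)^* : R[i]^o) A
  = (\sum_(i <- A) cabs (b i) ^+ 2)%:C%C :> R[i].
Proof.
rewrite ps_sum [RHS]rmorph_sum /=; apply: eq_bigr => i _.
by rewrite -normCK cabsE -rmorphXn.
Qed.

Let dot_real_cvg b :
  (fun A : {fset I} => \sum_(i <- A) cabs (b i) ^+ 2) @ summability.totally
     --> complex.Re (ell2_dot b b).
Proof.
have /cvgrPdist_lt dc := @ell2_dot_cvg b b; apply/cvgrPdist_lt => e e0.
have /dc : 0 < e%:C%C by rewrite ltcR.
apply: filterS => A; rewrite Re_ps.
rewrite -[X in X < _]/(`|ell2_dot b b - (\sum_(i <- A) cabs (b i) ^+ 2)%:C%C|).
rewrite cabsE ltcR; apply: le_lt_trans; apply: le_trans (Re_le_cabs _).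
by case: (ell2_dot b b).
Qed.

Lemma ell2_dot_Im b : complex.Im (ell2_dot b b) = 0.
Proof.
have := ell2_dotC b b; case: (ell2_dot b b) => x y [] /eqP.
by rewrite -addr_eq0 -mulr2n mulrn_eq0 /= => /eqP.
Qed.

Lemma ell2_dot_ub b (A : {fset I}) :
  \sum_(i <- A) cabs (b i) ^+ 2 <= complex.Re (ell2_dot b b).
Proof.
apply: (cvgr_to_ge (@dot_real_cvg b)); apply: filterS (totallyS A) => B AB.
by apply: ler_sum_fsubset => // i; rewrite sqr_ge0.
Qed.

Lemma ell2_dot_lub b M : (forall A : {fset I}, \sum_(i <- A) cabs (b i) ^+ 2 <= M) ->
  complex.Re (ell2_dot b b) <= M.
Proof.
by move=> bM; apply: (cvgr_to_le (@dot_real_cvg b)); apply: nearW.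
Qed.

Lemma ell2_dotE b : ell2_dot b b = (complex.Re (ell2_dot b b))%:C%C.
Proof. by have := ell2_dot_Im b; case: (ell2_dot b b) => x y /= ->. Qed.

Lemma ell2_dot_ge0 b : 0 <= ell2_dot b b.
Proof.
rewrite ell2_dotE lecR; apply: le_trans (ell2_dot_ub b fset0).
by rewrite big_seq_fset0.
Qed.

Lemma ell2_dot_eq0 b : ell2_dot b b = 0 -> b = 0.
Proof.
move=> b0; apply: ell2_inj => i; apply: (@cabs_eq0 R); apply/eqP.
have := ell2_dot_ub b [fset i]%fset; rewrite big_seq_fset1 b0 /=.
by rewrite -[X in _ <= X]/(0 : R) -sqrf_eq0 => H; rewrite eq_le H sqr_ge0.
Qed.

Definition ell2_norm b : R[i] := sqrtC (ell2_dot b b).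

Fact ell2_normD b b' : ell2_norm (b + b') <= ell2_norm b + ell2_norm b'.
Proof.
exact: (sqrt_dotD ell2_dotP ell2_dotC ell2_dot_ge0 ell2_dot_eq0).
Qed.

Fact ell2_normZ a b : ell2_norm (a *: b) = `|a| * ell2_norm b.
Proof.
rewrite /ell2_norm.
have -> : ell2_dot (a *: b) (a *: b) = `|a| ^+ 2 * ell2_dot b b.
  have H (x y : ell2) : ell2_dot (a *: x) y = a * ell2_dot x y.
    rewrite -[a *: x]addr0 ell2_dotP; have := ell2_dotP 1 0 0 y.
    by rewrite scale1r addr0 mul1r -[LHS]addr0 => /addrI <-; rewrite addr0.
  by rewrite H ell2_dotC H rmorphM /= -ell2_dotC mulrA normCK.
by rewrite rootCMl ?exprn_ge0// sqrCK.
Qed.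

Fact ell2_norm_eq0 b : ell2_norm b = 0 -> b = 0.
Proof. by move/eqP; rewrite sqrtC_eq0 => /eqP/ell2_dot_eq0. Qed.

HB.instance Definition _ :=
  Lmodule_isNormed.Build R[i] ell2 ell2_normD ell2_normZ ell2_norm_eq0.

Lemma ell2_normE b : `|b| ^+ 2 = ell2_dot b b.
Proof. by rewrite -[ `|b| ]/(ell2_norm b) sqrtCK. Qed.

Lemma ell2_norm_ler b (r : R) : 0 <= r ->
  (`|b| <= r%:C%C) <->
  (forall A : {fset I}, \sum_(i <- A) cabs (b i) ^+ 2 <= r ^+ 2).
Proof.
move=> r0; rewrite -(@ler_pXn2r _ 2)// ?nnegrE ?lecR// ell2_normE ell2_dotE.
rewrite -rmorphXn /= lecR; split=> [+ A|]; last exact: ell2_dot_lub.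
exact: le_trans (ell2_dot_ub b A).
Qed.

Let sum_cvg (F : set_system ell2) (FF : Filter F) (l : I -> R[i]^o) b s :
  (forall i, (fun c : ell2 => c i) @ F --> l i) ->
  (fun c : ell2 => \sum_(i <- s) cabs (c i - b i) ^+ 2) @ F
    --> \sum_(i <- s) cabs (l i - b i) ^+ 2.
Proof.
move=> Fl; elim: s => [|i s IH].
  by rewrite big_nil; under eq_fun do rewrite big_nil; exact: cvg_cst.
rewrite big_cons; under eq_fun do rewrite big_cons.
apply: cvgD => //; rewrite expr2; under eq_fun do rewrite expr2.
suff H : (fun c : ell2 => cabs (c i - b i)) @ F --> cabs (l i - b i) by exact: cvgM.
apply/cvgrPdist_lt => e e0; have /cvgrPdist_lt/(_ e%:C%C) := Fl i.
rewrite ltcR => /(_ e0); apply: filterS => c.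
rewrite -[X in X < _]/(`|(l i : R[i]) - c i|) cabsE ltcR; apply: le_lt_trans.
rewrite ler_norml; apply/andP; split.
  rewrite lerNl opprB lerBlDr -(cabsN (_ - c i)).
  by apply: le_trans (cabsD _ _); rewrite opprB addrA subrK.
by rewrite lerBlDr; apply: le_trans (cabsD _ _); rewrite addrA subrK.
Qed.

Lemma ell2_complete (F : set_system ell2) : ProperFilter F -> cauchy F -> cvg F.
Proof.
move=> FF /cauchyP Fc.
have coord i : exists l : R[i]^o, (fun c : ell2 => c i) @ F --> l.
  apply: complex_complete; apply: cauchy_exP => e /gtc0P[r r0 ->].
  have [|b Fb] := Fc r%:C%C; first by rewrite ltcR.
  exists (b i); suff : F ((fun c : ell2 => c i) @^-1` ball (b i : R[i]^o) r%:C%C) by [].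
  apply: filterS Fb => c; rewrite /preimage /= -!ball_normE /= => bc.
  change (`|(b i : R[i]) - c i| < r%:C%C); rewrite cabsE; apply: le_lt_trans bc.
  set d := b - c.
  have -> : b i - c i = d i by [].
  have d0 : 0 <= complex.Re (ell2_dot d d).
    by rewrite -ler0c -ell2_dotE ell2_dot_ge0.
  rewrite -(@ler_pXn2r _ 2)// ?nnegrE ?ler0c ?cabs_ge0// ell2_normE ell2_dotE.
  rewrite -rmorphXn /= lecR.
  by have := ell2_dot_ub d [fset i]%fset; rewrite big_seq_fset1.
have {coord} [l Fl] := choice coord.
have key (r : R) b : 0 < r -> F (ball b r%:C%C) ->
    forall A : {fset I}, \sum_(i <- A) cabs (l i - b i) ^+ 2 <= r ^+ 2.
  move=> r0 Fb A; apply: (cvgr_to_le (@sum_cvg F _ l b A Fl)).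
  apply: filterS Fb => c; rewrite -ball_normE /= distrC => /ltW.
  by rewrite (ell2_norm_ler _ (ltW r0)) => /(_ A).
have lP : l \in ell2_pred.
  have [|b Fb] := Fc 1%:C%C; first by rewrite ltcR.
  have lb : (l - (b : I -> R[i]^o)) \in ell2_pred.
    by apply/asboolP/sqsummableP; exists (1 ^+ 2) => A; exact: (key 1 b ltr01 Fb A).
  by rewrite -[l](subrK (b : I -> R[i]^o)) rpredD// ell2_valP.
apply/cvg_ex; exists (Ell2 lP); apply/cvgrPdist_le => e /gtc0P[r r0 ->].
have r20 : 0 < r / 2 by rewrite divr_gt0.
have [|b Fb] := Fc (r / 2)%:C%C; first by rewrite ltcR.
have H := key _ _ r20 Fb.
have Hb : `|Ell2 lP - b| <= (r / 2)%:C%C.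
  by apply/(ell2_norm_ler _ (ltW r20)).
apply: filterS Fb => c; rewrite -ball_normE /= => /ltW bc.
rewrite -[Ell2 lP - c](_ : Ell2 lP - b + (b - c) = _); last by rewrite addrA subrK.
by apply: le_trans (ler_normD _ _) _; rewrite [r]splitr rmorphD /= lerD.
Qed.

HB.instance Definition _ := Uniform_isComplete.Build ell2 ell2_complete.

HB.instance Definition _ := isHilbert.Build R[i] ell2
  ell2_dotP ell2_dotC (fun b => esym (ell2_normE b)).

End Ell2.

(* The Hilbert space direct sum; the library norm on [H1 * H2] is the sup norm,
   hence the alias. *)
Definition hsum (C : numClosedFieldType) (H1 H2 : hilbertType C) : Type :=
  (H1 * H2)%type.

Section HSum.
Variables (C : numClosedFieldType) (H1 H2 : hilbertType C).
Local Notation H := (hsum H1 H2).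

HB.instance Definition _ := GRing.Lmodule.copy H (H1 * H2)%type.

Implicit Types x y : H.

Definition hsum_dot x y : C := hdot x.1 y.1 + hdot x.2 y.2.

Fact hsum_dotP a x y z :
  hsum_dot (a *: x + y) z = a * hsum_dot x z + hsum_dot y z.
Proof. by rewrite /hsum_dot /= !hdotP mulrDr addrACA. Qed.

Fact hsum_dotC x y : hsum_dot y x = (hsum_dot x y)^*.
Proof. by rewrite /hsum_dot rmorphD /= -!hdotC. Qed.

Fact hsum_dotE x : hsum_dot x x = `|x.1| ^+ 2 + `|x.2| ^+ 2.
Proof. by rewrite /hsum_dot !hdotE. Qed.

Fact hsum_dot_ge0 x : 0 <= hsum_dot x x.
Proof. by rewrite hsum_dotE addr_ge0// exprn_ge0. Qed.

Fact hsum_dot_eq0 x : hsum_dot x x = 0 -> x = 0.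
Proof.
move/eqP; rewrite hsum_dotE paddr_eq0 ?exprn_ge0//.
rewrite !expf_eq0 /= !normr_eq0 => /andP[/eqP x1 /eqP x2].
by rewrite [x]surjective_pairing x1 x2.
Qed.

Definition hsum_norm x : C := sqrtC (hsum_dot x x).

Fact hsum_normD x y : hsum_norm (x + y) <= hsum_norm x + hsum_norm y.
Proof.
exact: (sqrt_dotD hsum_dotP hsum_dotC hsum_dot_ge0 hsum_dot_eq0).
Qed.

Fact hsum_normZ a x : hsum_norm (a *: x) = `|a| * hsum_norm x.
Proof.
rewrite /hsum_norm !hsum_dotE /= !normrZ !exprMn -mulrDr.
by rewrite rootCMl ?exprn_ge0// sqrCK.
Qed.

Fact hsum_norm_eq0 x : hsum_norm x = 0 -> x = 0.
Proof. by move/eqP; rewrite sqrtC_eq0 => /eqP/hsum_dot_eq0. Qed.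

HB.instance Definition _ :=
  Lmodule_isNormed.Build C H hsum_normD hsum_normZ hsum_norm_eq0.

Lemma hsum_normE x : `|x| ^+ 2 = `|x.1| ^+ 2 + `|x.2| ^+ 2.
Proof. by rewrite -[ `|x| ]/(hsum_norm x) sqrtCK hsum_dotE. Qed.

Lemma hsum_norm1 x : `|x.1| <= `|x|.
Proof.
by rewrite -(@ler_pXn2r _ 2)// ?nnegrE// hsum_normE lerDl exprn_ge0.
Qed.

Lemma hsum_norm2 x : `|x.2| <= `|x|.
Proof.
by rewrite -(@ler_pXn2r _ 2)// ?nnegrE// hsum_normE lerDr exprn_ge0.
Qed.

Lemma hsum_norm_le x : `|x| <= `|x.1| + `|x.2|.
Proof.
rewrite -(@ler_pXn2r _ 2)// ?nnegrE ?addr_ge0// hsum_normE sqrrD addrAC lerDl.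
by rewrite mulrn_wge0// mulr_ge0.
Qed.

Lemma hsum_complete (F : set_system H) : ProperFilter F -> cauchy F -> cvg F.
Proof.
move=> FF /cauchyP Fc.
have cau (H' : hilbertType C) (h : H -> H') :
    (forall x y, `|h x - h y| <= `|x - y|) -> cvg (h @ F).
  move=> hE; apply: cauchy_cvg; apply: cauchy_exP => e e0.
  have [x Fx] := Fc e e0; exists (h x); suff : F (h @^-1` ball (h x) e) by [].
  apply: filterS Fx => y; rewrite /preimage /= -!ball_normE /=.
  exact: le_lt_trans.
have /cvg_ex[l1 /cvgrPdist_lt Fl1] : cvg ((fun x : H => x.1) @ F).
  by apply: cau => x y; exact: (hsum_norm1 (x - y)).
have /cvg_ex[l2 /cvgrPdist_lt Fl2] : cvg ((fun x : H => x.2) @ F).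
  by apply: cau => x y; exact: (hsum_norm2 (x - y)).
apply/cvg_ex; exists ((l1, l2) : H); apply/cvgrPdist_lt => e e0.
have e20 : 0 < e / 2 by rewrite divr_gt0.
have {}Fl1 := Fl1 _ e20; have {}Fl2 := Fl2 _ e20.
near=> x; apply: le_lt_trans (hsum_norm_le _) _; rewrite [e]splitr ltrD//=.
  by near: x.
by near: x.
Unshelve. all: by end_near. Qed.

HB.instance Definition _ := Uniform_isComplete.Build H hsum_complete.

HB.instance Definition _ := isHilbert.Build C H
  hsum_dotP hsum_dotC (fun x => etrans (hsum_dotE x) (esym (hsum_normE x))).

End HSum.

Section Operators.
Variables (R : realType) (H : hilbertType R[i]).

Definition bounded_op (T : H -> H) : Prop :=
  linear T /\ exists M : R, forall x, `|T x| <= M%:C%C * `|x|.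

Definition adjoint_pair (S T : H -> H) : Prop :=
  forall x y, hdot (S x) y = hdot x (T y).

Definition compact_op (T : H -> H) : Prop :=
  bounded_op T /\ precompact (T @` [set x | `|x| <= 1]).

(* Unbounded operators are represented by their graphs. *)
Implicit Types D E : set (H * H).

Definition op_graph (T : H -> H) : set (H * H) := [set p | p.2 = T p.1].

Definition is_operator D : Prop :=
  [/\ D (0, 0),
      forall (a : R[i]) x y x' y', D (x, y) -> D (x', y') ->
        D (a *: x + x', a *: y + y')
    & forall x y y', D (x, y) -> D (x, y') -> y = y'].

Definition op_dom D : set H := [set x | exists y, D (x, y)].

Definition op_comp D E : set (H * H) :=
  [set p | exists2 y, E (p.1, y) & D (y, p.2)].

Definition op_adjoint D : set (H * H) :=
  [set p | forall q, D q -> hdot q.2 p.1 = hdot q.1 p.2].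

Definition selfadjoint D : Prop :=
  [/\ is_operator D, dense (op_dom D) & op_adjoint D = D].

Definition positive_op D : Prop := forall p, D p -> 0 <= hdot p.2 p.1.

(* [E] is |D|, the positive square root of D^* D. *)
Definition is_abs_op D E : Prop :=
  [/\ selfadjoint E, positive_op E
    & op_comp E E = op_comp (op_adjoint D) D].

(* [S] is (1 + D^2)^(-1/2), the positive square root of the inverse of 1 + D^2. *)
Definition is_inv_sqrt_1D2 D (S : H -> H) : Prop :=
  [/\ bounded_op S, positive_op (op_graph S)
    & op_graph (S \o S) =
      [set p | exists2 z, op_comp D D (p.2, z) & p.1 = p.2 + z]].

Definition preserves_dom D (T : H -> H) : Prop :=
  forall x, op_dom D x -> op_dom D (T x).

(* [D, T] = D T - T D, on the domain of D *)
Definition commutator D (T : H -> H) : set (H * H) :=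
  [set p | exists y z, [/\ D (p.1, y), D (T p.1, z) & p.2 = z - T y]].

Definition bounded_extension (X : set (H * H)) (S : H -> H) : Prop :=
  bounded_op S /\ X `<=` op_graph S.

(* The commutator of the next order is taken with the bounded extension of the
   previous one, which is unique since E is densely defined. *)
Fixpoint dom_ad E (k : nat) (T : H -> H) : Prop :=
  if k is k'.+1 then
    [/\ bounded_op T, preserves_dom E T
      & exists2 S, bounded_extension (commutator E T) S & dom_ad E k' S]
  else bounded_op T.

End Operators.

Section CstarAlgebras.
Variables (R : realType) (K : hilbertType R[i]).
Implicit Types A : set (K -> K).

Record star_algebra_of_ops A : Prop := StarAlgebraOfOps {
  star_alg_bounded : forall T, A T -> bounded_op T ;
  star_alg0 : A (fun=> 0) ;
  star_alg_lin : forall (a : R[i]) S T, A S -> A T -> A (fun x => a *: S x + T x) ;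
  star_alg_comp : forall S T, A S -> A T -> A (S \o T) ;
  star_alg_adj : forall T, A T -> exists2 S, A S & adjoint_pair T S }.

(* closure for the operator norm *)
Definition op_closure A : set (K -> K) :=
  [set T | bounded_op T /\ forall e : R, 0 < e ->
     exists2 S, A S & forall x, `|T x - S x| <= e%:C%C * `|x|].

(* C^*-algebras are taken in concrete form: norm-closed *-algebras of operators. *)
Definition cstar_algebra A : Prop :=
  star_algebra_of_ops A /\ op_closure A `<=` A.

Definition dense_star_subalgebra A (A0 : set (K -> K)) : Prop :=
  [/\ star_algebra_of_ops A0, A0 `<=` A & A `<=` op_closure A0].

Variable H : hilbertType R[i].
Implicit Types (rho : (K -> K) -> (H -> H)) (D : set (H * H)).

Record star_representation A rho : Prop := StarRepresentation {
  star_rep_bounded : forall T, A T -> bounded_op (rho T) ;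
  star_rep_lin : forall (a : R[i]) S T, A S -> A T ->
    rho (fun x => a *: S x + T x) = (fun x => a *: rho S x + rho T x) ;
  star_rep_comp : forall S T, A S -> A T -> rho (S \o T) = rho S \o rho T ;
  star_rep_adj : forall S T, A S -> A T ->
    adjoint_pair S T -> adjoint_pair (rho S) (rho T) }.

(* A spectral triple for [A], except for the compactness condition. *)
Record spectral_datum A rho (A0 : set (K -> K)) D : Prop := SpectralDatum {
  spectral_cstar : cstar_algebra A ;
  spectral_dense : dense_star_subalgebra A A0 ;
  spectral_rep : star_representation A rho ;
  spectral_selfadjoint : selfadjoint D ;
  spectral_dom : forall a, A0 a -> preserves_dom D (rho a) ;
  spectral_comm : forall a, A0 a ->
    exists B, bounded_extension (commutator D (rho a)) B }.

Record spectral_triple A rho (A0 : set (K -> K)) D : Prop := SpectralTriple {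
  spectral_triple_datum : spectral_datum A rho A0 D ;
  spectral_compact : exists2 S, is_inv_sqrt_1D2 D S &
    forall a, A0 a -> compact_op (rho a \o S) }.

(* Both [rho a] and (the bounded extension of) [D, rho a] lie in the domain of
   ad^k(|D|). *)
Definition ad_smooth rho D (k : nat) (a : K -> K) : Prop :=
  exists E B, [/\ is_abs_op D E, preserves_dom D (rho a),
    bounded_extension (commutator D (rho a)) B,
    dom_ad E k (rho a) & dom_ad E k B].

Definition QC rho (A0 : set (K -> K)) D (k : nat) : set (K -> K) :=
  [set a | A0 a /\ ad_smooth rho D k a].

Definition quantum_C rho (A0 : set (K -> K)) D (k : nat) : Prop :=
  forall a, A0 a -> ad_smooth rho D k a.

End CstarAlgebras.

Section TwistedGroupAlgebra.
Variables (R : realType) (L : zmodType) (c : L -> L -> R[i]).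
Implicit Types (a b : L -> R[i]) (w : L -> R).

Definition tconv a b : L -> R[i] := fun l =>
  summability.sum (fun m => a m * b (l - m) * c m (l - m) : R[i]^o).

Definition tstar a : L -> R[i] := fun l => c l l * (a (- l))^*.

Definition ell1 : set (L -> R[i]) :=
  [set a | (\esum_(l in [set: L]) (cabs (a l))%:E < +oo)%E].

Definition ell1w w : set (L -> R[i]) :=
  [set a | ell1 a /\ (\esum_(l in [set: L]) (cabs (a l) * w l)%:E < +oo)%E].

(* Left twisted convolution on ell^2. It maps ell^2 to itself when [a] is in
   ell^1; the default value [0] is only reached for other [a]. *)
Definition lconv a (b : ell2 R L) : ell2 R L :=
  insubd (0 : ell2 R L) (tconv a b : L -> R[i]^o).

(* The norm closure of the left twisted convolution operators on ell^2, that is,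
   the reduced completion of ell^1; it is also the full one as [L] is abelian. *)
Definition twisted_cstar : set (ell2 R L -> ell2 R L) :=
  op_closure [set lconv a | a in ell1].

(* [A], with twisted convolution and involution, is a *-algebra which [lconv]
   embeds in the algebra of operators on ell^2. *)
Record star_embedding (A : set (L -> R[i])) : Prop := StarEmbedding {
  star_emb_lin : forall x a b, A a -> A b -> A (fun l => x * a l + b l) ;
  star_emb_conv : forall a b, A a -> A b -> A (tconv a b) ;
  star_emb_star : forall a, A a -> A (tstar a) ;
  lconv_lin : forall x a b, A a -> A b ->
    lconv (fun l => x * a l + b l) = (fun d => x *: lconv a d + lconv b d) ;
  lconv_conv : forall a b, A a -> A b -> lconv (tconv a b) = lconv a \o lconv b ;
  lconv_star : forall a, A a -> adjoint_pair (lconv a) (lconv (tstar a)) ;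
  lconv_inj : forall a b, A a -> A b -> lconv a = lconv b -> a = b }.

Definition diag_rep (T : ell2 R L -> ell2 R L)
    (p : hsum (ell2 R L) (ell2 R L)) : hsum (ell2 R L) (ell2 R L) :=
  (T p.1, T p.2).

(* multiplication by [g] on its maximal domain *)
Definition mul_op (g : L -> R) : set (ell2 R L * ell2 R L) :=
  [set p : ell2 R L * ell2 R L | forall l, p.2 l = (g l)%:C%C * p.1 l].

(* the diagonal block operator with blocks [S] and [T] *)
Definition diag_op (S T : set (ell2 R L * ell2 R L)) :
    set (hsum (ell2 R L) (ell2 R L) * hsum (ell2 R L) (ell2 R L)) :=
  [set p : hsum (ell2 R L) (ell2 R L) * hsum (ell2 R L) (ell2 R L) |
     S (p.1.1, p.2.1) /\ T (p.1.2, p.2.2)].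

End TwistedGroupAlgebra.

Section PontryaginDual.
Variables (R : realType) (G : topologicalZmodType).

Definition dual_pred : {pred G -> R[i]^o} := fun chi =>
  `[< [/\ continuous chi, forall x, `|chi x| = 1
        & forall x y, chi (x + y) = chi x * chi y] >].

Record dual := Dual { char :> G -> R[i]^o ; charP : char \in dual_pred }.

HB.instance Definition _ := [isSub for char].
HB.instance Definition _ := [Choice of dual by <:].

Lemma dual_cont (chi : dual) : continuous chi.
Proof. by case: chi => ? /= /asboolP[]. Qed.

Lemma dual_norm (chi : dual) x : `|chi x| = 1.
Proof. by case: chi => ? /= /asboolP[]. Qed.

Lemma dualD (chi : dual) x y : chi (x + y) = chi x * chi y.
Proof. by case: chi => ? /= /asboolP[]. Qed.

Lemma dual_inj (chi psi : dual) : (chi : G -> R[i]^o) =1 psi -> chi = psi.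
Proof. by move=> E; apply: val_inj; apply/funext. Qed.

Fact dual_one_subproof : (fun=> 1 : R[i]^o) \in dual_pred.
Proof.
apply/asboolP; split => [x|x|x y]; [exact: cvg_cst|by rewrite normr1|by rewrite mulr1].
Qed.

Fact dual_mul_subproof (chi psi : dual) :
  (fun x => chi x * psi x : R[i]^o) \in dual_pred.
Proof.
apply/asboolP; split => [x|x|x y].
- exact: (cvgZ (@dual_cont chi x) (@dual_cont psi x)).
- by rewrite -[LHS]/(`|(chi x : R[i]) * psi x|) normrM !dual_norm mulr1.
by rewrite !dualD mulrACA.
Qed.

Fact dual_inv_subproof (chi : dual) : (fun x => (chi x)^* : R[i]^o) \in dual_pred.
Proof.
apply/asboolP; split => [x|x|x y].
- have /cvgrPdist_lt cx := @dual_cont chi x.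
  apply/cvgrPdist_lt => e /cx; apply: filterS => y.
  by move=> H; rewrite -[X in X < _]/(`|(chi x : R[i])^* - (chi y)^*|)
    -rmorphB norm_conjC.
- by rewrite -[LHS]/(`|(chi x : R[i])^*|) norm_conjC dual_norm.
by rewrite dualD rmorphM.
Qed.

(* The group law of the dual is written additively. *)
Definition dual0 := Dual dual_one_subproof.
Definition dual_add chi psi := Dual (dual_mul_subproof chi psi).
Definition dual_opp chi := Dual (dual_inv_subproof chi).

Fact dual_addA : associative dual_add.
Proof. by move=> a b d; apply: dual_inj => x /=; rewrite mulrA. Qed.
Fact dual_addC : commutative dual_add.
Proof. by move=> a b; apply: dual_inj => x /=; rewrite mulrC. Qed.
Fact dual_add0 : left_id dual0 dual_add.
Proof. by move=> a; apply: dual_inj => x /=; rewrite mul1r. Qed.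
Fact dual_addN : left_inverse dual0 dual_opp dual_add.
Proof.
move=> a; apply: dual_inj => x /=.
by rewrite mulrC -[LHS]/((a x : R[i]) * (a x)^*) -normCK dual_norm expr1n.
Qed.

HB.instance Definition _ :=
  GRing.isZmodule.Build dual dual_addA dual_addC dual_add0 dual_addN.

HB.instance Definition _ := Topological.copy dual
  (initial_topology (char : dual -> {compact-open, G -> R[i]^o})).

Definition phase_space : Type := (G * dual)%type.
HB.instance Definition _ := GRing.Zmodule.copy phase_space (G * dual)%type.
HB.instance Definition _ := Topological.copy phase_space (G * dual)%type.

End PontryaginDual.

Section Lattices.
Variable X : zmodType.

Record subgroup_elt (L : zmodClosed X) :=
  SubgroupElt { elt_val : X ; elt_valP : elt_val \in L }.

Variable L : zmodClosed X.
HB.instance Definition _ := [isSub for @elt_val L].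
HB.instance Definition _ := [Choice of subgroup_elt L by <:].
HB.instance Definition _ := [SubChoice_isSubZmodule of subgroup_elt L by <:].
End Lattices.

Section PhaseSpace.
Variables (R : realType) (G : topologicalZmodType).
Local Notation X := (phase_space R G).

Definition is_lattice (L : zmodClosed X) : Prop :=
  (forall x, x \in L -> isolated [set` L] x) /\
  compact [set: quotient_topology {ideal_quot L}].

Record invariant_metric (d : X -> X -> R) : Prop := InvariantMetric {
  inv_metric_ge0 : forall x y, 0 <= d x y ;
  inv_metric_eq0 : forall x y, d x y = 0 <-> x = y ;
  inv_metric_sym : forall x y, d x y = d y x ;
  inv_metric_triangle : forall x y z, d x z <= d x y + d y z ;
  inv_metric_trans : forall x y z, d (x + z) (y + z) = d x y ;
  inv_metric_nbhs : forall x (U : set X), nbhs x U <->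
    exists2 e : R, 0 < e & [set y | d x y < e] `<=` U }.

Record weight (v : X -> R) : Prop := Weight {
  weight_ge0 : forall x, 0 <= v x ;
  weight_neq0 : v 0 <> 0 ;
  weight_submul : forall x y, v (x + y) <= v x * v y ;
  weight_growth : exists d C s, [/\ invariant_metric d, 0 < C, 0 < s
    & forall x, v x <= C * (1 + d x 0) `^ s] ;
  weight_sym : forall x, v x = v (- x) }.

Record spectral_compatible (f : R -> R) (v : X -> R) (L : zmodClosed X) : Prop :=
  SpectralCompatible {
  compatible_ge0 : forall t, 0 <= t -> 0 <= f t ;
  compatible_dif : exists2 C, 0 <= C & forall l m, l \in L -> m \in L ->
    `|f (v (l + m)) - f (v l)| <= C * f (v m) ;
  compatible_sm : exists2 C, 0 <= C & forall l m, l \in L -> m \in L ->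
    f (v (l + m)) <= C * f (v l) * f (v m) ;
  compatible_gr : exists2 C, 0 <= C & forall l, l \in L -> f (v l) <= C * v l }.

Definition heisenberg (x y : X) : R[i] := (y.2 x.1)^*.

Variable L : zmodClosed X.

Definition lattice_cocycle (l m : subgroup_elt L) : R[i] := heisenberg (elt_val l) (elt_val m).

Definition ell1_algebra (v : X -> R) (n : nat) : set (subgroup_elt L -> R[i]) :=
  ell1w (fun l => v (elt_val l) ^+ n).

Definition ell1_ops (v : X -> R) (n : nat) :=
  [set lconv lattice_cocycle a | a in ell1_algebra v n].

Definition dirac_op (f : R -> R) (v : X -> R) :=
  let fv := mul_op (fun l : subgroup_elt L => f (v (elt_val l))) in diag_op fv fv.

(* f(v(l)) tends to infinity along the discrete group [L] *)
Definition coercive (f : R -> R) (v : X -> R) : Prop :=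
  forall M : R, finite_set [set l : subgroup_elt L | f (v (elt_val l)) <= M].

End PhaseSpace.

(* Main.v *)
(* Every operator involved has the form b |-> (l |-> sum_m k(l, m) b(l - m)) with
   |k(l, m)| <= w(m) and w summable, hence is bounded on ell^2 with norm at most the
   sum of w. Twisted convolution by a has the kernel a(m) c(m, l - m), and the commutator
   with multiplication by g = f(v) multiplies a kernel by g(l) - g(l - m), which is
   O(g(m)) = O(v(m)): j commutators with D cost a factor v(m)^j, and these are finite
   for a in ell^1_{v^n} as long as j <= n. Since D is positive, |D| = D. The resolvent
   (1 + D^2)^(-1/2) maps the unit ball into an ellipsoid with axes (1 + g(l)^2)^(-1/2),
   which is compact when g tends to infinity. *)
Require Import Defs.
From mathcomp Require Import all_boot all_order all_algebra.
From mathcomp Require Import all_classical all_reals all_analysis.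
From mathcomp Require Import complex finmap ring lra.
From mathcomp Require summability.

Set Implicit Arguments.
Unset Strict Implicit.
Unset Printing Implicit Defensive.

Import Order.TTheory GRing.Theory Num.Theory.
Import numFieldNormedType.Exports.

Local Open Scope classical_set_scope.
Local Open Scope ring_scope.

Section CabsLimits.
Variables (R : realType) (T : Type) (F : set_system T).
Context {FF : Filter F}.

Lemma cvg_cabs (u : T -> R[i]^o) (l : R[i]^o) :
  u @ F --> l -> (fun t => cabs (u t)) @ F --> cabs l.
Proof.
move=> /cvgrPdist_lt ul; apply/cvgrPdist_lt => e e0.
have /ul : 0 < e%:C%C by rewrite ltcR.
apply: filterS => t; rewrite -[X in X < _]/(`|_ - _ : R[i]|) cabsE ltcR.
apply: le_lt_trans; rewrite ler_norml; apply/andP; split.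
  rewrite lerNl opprB lerBlDr -(cabsN (_ - u t)).
  by apply: le_trans (cabsD _ _); rewrite opprB subrK.
by rewrite lerBlDr; apply: le_trans (cabsD _ _); rewrite subrK.
Qed.

Lemma cvg_cabs_sum (J : Type) (s : seq J) (u : J -> T -> R[i]^o)
    (l : J -> R[i]^o) (w : J -> R) (p : nat) :
  (forall j, u j @ F --> l j) ->
  (fun t => \sum_(j <- s) w j * cabs (u j t) ^+ p) @ F
    --> \sum_(j <- s) w j * cabs (l j) ^+ p.
Proof.
move=> ul; elim: s => [|j s IH].
  by rewrite big_nil; under eq_fun do rewrite big_nil; exact: cvg_cst.
rewrite big_cons; under eq_fun do rewrite big_cons.
apply: cvgD => //; apply: cvgM; first exact: cvg_cst.
elim: p {IH} => [|p IH]; first by under eq_fun do rewrite expr0; exact: cvg_cst.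
by rewrite exprS; under eq_fun do rewrite exprS; apply: cvgM => //; exact: cvg_cabs.
Qed.

End CabsLimits.

Section AbsoluteSums.
Variables (R : realType) (I : choiceType).
Implicit Types u w : I -> R[i].

Definition abs_summable u :=
  exists M : R, forall A : {fset I}, \sum_(i <- A) cabs (u i) <= M.

Lemma abs_summable_le (g : I -> R) u (M : R) : (forall i, cabs (u i) <= g i) ->
  (forall A : {fset I}, \sum_(i <- A) g i <= M) -> abs_summable u.
Proof.
by move=> ug gM; exists M => A; apply: le_trans (gM A); apply: ler_sum => i _.
Qed.

Lemma abs_summable_cvg u : abs_summable u ->
  summability.partial_sum (u : I -> R[i]^o) @ summability.totally
    --> (summability.sum (u : I -> R[i]^o) : R[i]^o).
Proof. by case=> M uM; exact: (@abs_cvg R I u M). Qed.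

Lemma sum_unique u (l : R[i]) :
  summability.partial_sum (u : I -> R[i]^o) @ summability.totally --> (l : R[i]^o) ->
  summability.sum (u : I -> R[i]^o) = l.
Proof. by move=> /cvg_lim <-. Qed.

Lemma eq_sum u w : u =1 w ->
  summability.sum (u : I -> R[i]^o) = summability.sum (w : I -> R[i]^o).
Proof. by move=> /funext ->. Qed.

Lemma sum_linear (a : R[i]) u w : abs_summable u -> abs_summable w ->
  summability.sum (fun i => a * u i + w i : R[i]^o)
  = a * summability.sum (u : I -> R[i]^o) + summability.sum (w : I -> R[i]^o).
Proof.
move=> /abs_summable_cvg uc /abs_summable_cvg wc; apply: sum_unique.
have H := cvgD (cvgZl_tmp (k := a) uc) wc.
apply: cvg_trans (H _ _); apply: near_eq_cvg; apply: nearW => A /=.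
rewrite [RHS]partial_sumE.
rewrite -[LHS]/(a * summability.partial_sum _ A + summability.partial_sum _ A).
by rewrite !partial_sumE mulr_sumr -big_split.
Qed.

Lemma sum_single u (p : I) : (forall i, i != p -> u i = 0) ->
  summability.sum (u : I -> R[i]^o) = u p.
Proof.
move=> up; apply: sum_unique; apply: cvg_near_cst.
apply: filterS (totallyS [fset p]%fset) => A /= pA; rewrite partial_sumE.
rewrite (big_fsetD1 p) /=; last by apply: (fsubsetP pA); rewrite inE.
rewrite big1_seq ?addr0// => i /andP[_]; rewrite !inE => /andP[ip _].
exact: up.
Qed.

Lemma sum_scale (a : R[i]) u : abs_summable u ->
  summability.sum (fun i => a * u i : R[i]^o) = a * summability.sum (u : I -> R[i]^o).
Proof.
move=> /abs_summable_cvg uc; apply: sum_unique.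
apply: cvg_trans (cvgZl_tmp (k := a) uc); apply: near_eq_cvg; apply: nearW => A /=.
by rewrite -[LHS]/(a * summability.partial_sum _ A) !partial_sumE mulr_sumr.
Qed.

Lemma sum_bound (T : choiceType) (A : {fset T}) (u : T -> I -> R[i])
    (w : T -> R) (p : nat) (M : R) :
  (forall t, abs_summable (u t)) ->
  (forall B : {fset I}, \sum_(t <- A) w t * cabs (\sum_(i <- B) u t i) ^+ p <= M) ->
  \sum_(t <- A) w t * cabs (summability.sum (u t : I -> R[i]^o)) ^+ p <= M.
Proof.
move=> us uM.
have H : (fun B : {fset I} =>
    \sum_(t <- A) w t * cabs (summability.partial_sum (u t : I -> R[i]^o) B) ^+ p)
    @ summability.totally --> \sum_(t <- A) w t * cabs (summability.sum (u t : I -> R[i]^o)) ^+ p.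
  by apply: cvg_cabs_sum => t; exact: abs_summable_cvg.
apply: (cvgr_to_le H); apply: nearW => B /=.
by under eq_bigr do rewrite partial_sumE.
Qed.

End AbsoluteSums.

Section RealNorm.
Variables (R : realType) (V : normedModType R[i]).
Implicit Types x y : V.

Definition rnorm x : R := complex.Re `|x|.

Lemma rnormE x : `|x| = (rnorm x)%:C%C.
Proof.
have := normr_ge0 x; rewrite /rnorm; case: `|x| => a b.
by rewrite lecE /= => /andP[/eqP -> _].
Qed.

Lemma rnorm_ge0 x : 0 <= rnorm x.
Proof. by rewrite -ler0c -rnormE. Qed.

Lemma rnormD x y : rnorm (x + y) <= rnorm x + rnorm y.
Proof. by rewrite -lecR rmorphD /= -!rnormE ler_normD. Qed.

Lemma rnormN x : rnorm (- x) = rnorm x.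
Proof. by rewrite /rnorm normrN. Qed.

Lemma rnorm_le x (r : R) : (rnorm x <= r) = (`|x| <= r%:C%C).
Proof. by rewrite rnormE lecR. Qed.

Lemma rnorm0 : rnorm 0 = 0.
Proof. by rewrite /rnorm normr0. Qed.

Lemma rnorm0_eq0 x : rnorm x <= 0 -> x = 0.
Proof. by rewrite rnorm_le => ?; apply/eqP; rewrite -normr_le0. Qed.

Lemma rnorm_sum (T : Type) (s : seq T) (x : T -> V) :
  rnorm (\sum_(i <- s) x i) <= \sum_(i <- s) rnorm (x i).
Proof.
elim: s => [|i s IH]; first by rewrite !big_nil /rnorm normr0.
by rewrite !big_cons; apply: le_trans (rnormD _ _) _; rewrite lerD2l.
Qed.

End RealNorm.

Lemma rnorm_bound (R : realType) (V W : normedModType R[i]) (x : V) (y : W)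
    (M : R) : (`|x| <= M%:C%C * `|y|) = (rnorm x <= M * rnorm y).
Proof. by rewrite !rnormE -rmorphM /= lecR. Qed.

Section Tails.
Variables (R : realType) (I : choiceType).

Lemma sum_fsetU_mem (g : I -> R) (A B : {fset I}) :
  \sum_(i <- (A `|` B)%fset | i \in A) g i = \sum_(i <- A) g i.
Proof.
rewrite -big_filter; apply: perm_big; apply: uniq_perm.
- by rewrite filter_uniq// fset_uniq.
- exact: fset_uniq.
by move=> i; rewrite mem_filter inE; case: (i \in A).
Qed.

Lemma sum_tail (g : I -> R) (M e : R) : (forall i, 0 <= g i) ->
  (forall A : {fset I}, \sum_(i <- A) g i <= M) -> 0 < e ->
  exists A : {fset I}, forall B : {fset I},
    \sum_(i <- B) (if i \in A then 0 else g i) <= e.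
Proof.
move=> g0 gM e0; set S := [set \sum_(i <- A) g i | A in [set: {fset I}]].
have supS : has_sup S.
  split; first by exists (\sum_(i <- fset0) g i); exists fset0.
  by exists M => _ [A _ <-].
have [_ [A _ <-] SA] := sup_adherent e0 supS.
exists A => B; have BS : \sum_(i <- (A `|` B)%fset) g i <= sup S.
  by apply: sup_upper_bound => //; exists (A `|` B)%fset.
set h := fun i => if i \in A then 0 else g i.
have h0 i : 0 <= h i by rewrite /h; case: ifP.
apply: (le_trans (ler_sum_fsubset h0 (fsubsetUr A B))).
have -> : \sum_(i <- (A `|` B)%fset) h i
    = \sum_(i <- (A `|` B)%fset) g i - \sum_(i <- A) g i.
  rewrite [in RHS](bigID (mem A)) /=.
  rewrite sum_fsetU_mem.
  rewrite addrAC subrr add0r [RHS]big_mkcond /=.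
  by apply: eq_bigr => i _; rewrite /h; case: (i \in A).
by rewrite lerBlDr -lerBlDl (le_trans _ (ltW SA))// lerD2r.
Qed.

End Tails.

Section Ell2Theory.
Variables (R : realType) (I : choiceType).
Implicit Types b d : ell2 R I.

Lemma ell2_sum_le b (A : {fset I}) : \sum_(i <- A) cabs (b i) ^+ 2 <= rnorm b ^+ 2.
Proof.
have H : `|b| <= (rnorm b)%:C%C by rewrite -rnormE.
by have [/(_ H)] := ell2_norm_ler b (rnorm_ge0 b).
Qed.

Lemma ell2_norm_le b (r : R) : 0 <= r ->
  (forall A : {fset I}, \sum_(i <- A) cabs (b i) ^+ 2 <= r ^+ 2) -> rnorm b <= r.
Proof. by move=> r0 H; rewrite rnorm_le; apply/ell2_norm_ler. Qed.

Lemma ell2_coord_le b i : cabs (b i) <= rnorm b.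
Proof.
rewrite -(@ler_pXn2r _ 2)// ?nnegrE ?cabs_ge0 ?rnorm_ge0//.
by have := ell2_sum_le b [fset i]%fset; rewrite big_seq_fset1.
Qed.

Lemma ell2_predP (x : I -> R[i]^o) (r : R) :
  (forall A : {fset I}, \sum_(i <- A) cabs (x i) ^+ 2 <= r) -> x \in @ell2_pred R I.
Proof. by move=> xr; apply/asboolP/sqsummableP; exists r. Qed.

Lemma ell2_domP (x : I -> R[i]^o) b (r : R) :
  (forall i, cabs (x i) <= r * cabs (b i)) -> x \in @ell2_pred R I.
Proof.
move=> xb; apply: (@ell2_predP _ (r ^+ 2 * rnorm b ^+ 2)) => A.
apply: (@le_trans _ _ (r ^+ 2 * \sum_(i <- A) cabs (b i) ^+ 2)).
  rewrite mulr_sumr; apply: ler_sum => i _; rewrite -exprMn.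
  by rewrite lerXn2r// ?nnegrE ?cabs_ge0// (le_trans (cabs_ge0 _) (xb i)).
by rewrite ler_wpM2l ?sqr_ge0// ell2_sum_le.
Qed.

Lemma ell2_dom_norm b d (r : R) : 0 <= r ->
  (forall i, cabs (d i) <= r * cabs (b i)) -> rnorm d <= r * rnorm b.
Proof.
move=> r0 db; apply: ell2_norm_le => [|A]; first by rewrite mulr_ge0 ?rnorm_ge0.
apply: (@le_trans _ _ (r ^+ 2 * \sum_(i <- A) cabs (b i) ^+ 2)).
  rewrite mulr_sumr; apply: ler_sum => i _; rewrite -exprMn.
  by rewrite lerXn2r// ?nnegrE ?cabs_ge0// mulr_ge0 ?cabs_ge0.
by rewrite exprMn ler_wpM2l ?sqr_ge0// ell2_sum_le.
Qed.

Lemma ell2_addE b d i : (b + d) i = b i + d i. Proof. by []. Qed.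
Lemma ell2_oppE b i : (- b) i = - b i. Proof. by []. Qed.
Lemma ell2_scaleE (a : R[i]) b i : (a *: b) i = a * b i. Proof. by []. Qed.
Lemma ell2_zeroE i : (0 : ell2 R I) i = 0. Proof. by []. Qed.
Definition ell2E := (ell2_addE, ell2_oppE, ell2_scaleE, ell2_zeroE).

Lemma ell2_sumE (T : Type) (s : seq T) (x : T -> ell2 R I) i :
  (\sum_(t <- s) x t) i = \sum_(t <- s) x t i.
Proof. by apply: (big_morph (fun b : ell2 R I => b i)). Qed.

Fact delta_subproof (p : I) :
  (fun i => if i == p then 1 else 0 : R[i]^o) \in @ell2_pred R I.
Proof.
apply: (@ell2_predP _ 1) => A; have [pA|pA] := boolP (p \in A); last first.
  rewrite big1_seq // => i /andP[_ iA]; case: eqP => [ip|_].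
    by rewrite -ip iA in pA.
  by rewrite /cabs normr0 expr0n.
rewrite (big_fsetD1 p) //= eqxx big1_seq => [|i /andP[_]].
  by rewrite addr0 /cabs normr1 expr1n.
by rewrite !inE => /andP[/negPf -> _]; rewrite /cabs normr0 expr0n.
Qed.

Definition delta p : ell2 R I := Ell2 (delta_subproof p).

Lemma deltaE p i : delta p i = (i == p)%:R.
Proof. by rewrite /= ; case: eqP. Qed.

Definition ell2_trunc (A : {fset I}) b := \sum_(p <- A) b p *: delta p.

Lemma ell2_truncE A b i : ell2_trunc A b i = if i \in A then b i else 0.
Proof.
rewrite ell2_sumE; under eq_bigr do rewrite ell2E deltaE.
have [iA|iA] := boolP (i \in A).
  rewrite (big_fsetD1 i) //= big1_seq => [|p /andP[_]].
    by rewrite eqxx mulr1 addr0.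
  by rewrite !inE eq_sym => /andP[/negPf -> _]; rewrite mulr0.
rewrite big1_seq// => p /andP[_ pA]; case: eqP => [ip|_]; last by rewrite mulr0.
by rewrite ip pA in iA.
Qed.

Lemma ell2_trunc_approx b (e : R) : 0 < e ->
  exists A : {fset I}, rnorm (b - ell2_trunc A b) <= e.
Proof.
move=> e0; have [|||A HA] := @sum_tail R I (fun i => cabs (b i) ^+ 2) (rnorm b ^+ 2) (e ^+ 2).
- by move=> i; rewrite sqr_ge0.
- exact: ell2_sum_le.
- by rewrite exprn_gt0.
exists A; apply: ell2_norm_le; first exact: ltW.
move=> B; apply: le_trans (HA B); apply: ler_sum => i _.
rewrite !ell2E ell2_truncE; case: ifP => _; last by rewrite subr0.
by rewrite subrr /cabs normr0 expr0n.
Qed.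

Lemma le0_eps (x M : R) : (forall e, 0 < e -> x <= M * e) -> x <= 0.
Proof.
move=> H; rewrite leNgt; apply/negP => x0.
have M0 : 0 < M by have := H 1 ltr01; rewrite mulr1; apply: lt_le_trans.
have /H : 0 < x / (2 * M) by rewrite divr_gt0// mulr_gt0.
suff -> : M * (x / (2 * M)) = x / 2 by lra.
by field; rewrite gt_eqF.
Qed.

Lemma ell2_ext (V : normedModType R[i]) (T : ell2 R I -> V) (M : R) :
  linear T -> (forall b, rnorm (T b) <= M * rnorm b) ->
  (forall p, T (delta p) = 0) -> forall b, T b = 0.
Proof.
move=> Tlin TM Td b; apply: rnorm0_eq0; apply: (@le0_eps _ `|M|) => e e0.
have [A HA] := ell2_trunc_approx b e0.
have T0 : T 0 = 0.
  by have := Tlin (-1) 0 0; rewrite scaler0 addr0 scaleN1r addNr.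
have TA : T (ell2_trunc A b) = 0.
  rewrite /ell2_trunc; elim: (A : seq I) => [|p s IH]; first by rewrite big_nil.
  by rewrite big_cons Tlin Td scaler0 add0r.
have -> : T b = T (b - ell2_trunc A b).
  have := Tlin (-1) (ell2_trunc A b) b.
  by rewrite TA scaler0 add0r scaleN1r addrC.
apply: le_trans (TM _) _; apply: le_trans (ler_norm _) _.
by rewrite normrM ler_wpM2l// ger0_norm ?rnorm_ge0.
Qed.

Lemma hdot_ell2E b d : hdot b d = ell2_dot b d. Proof. by []. Qed.

Lemma hdot_delta b p : hdot b (delta p) = b p.
Proof.
rewrite hdot_ell2E /ell2_dot (@sum_single _ _ (fun i => b i * (delta p i)^*) p).
  by rewrite deltaE eqxx conjC1 mulr1.
by move=> i /negPf ip; rewrite deltaE ip conjC0 mulr0.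
Qed.

End Ell2Theory.

Section HdotTheory.
Variables (R : realType) (H : hilbertType R[i]).
Implicit Types x y z : H.

Lemma hdot0l z : hdot 0 z = 0 :> R[i].
Proof. by have := hdotP 1 0 0 z; rewrite scale1r addr0 mul1r -[LHS]addr0 => /addrI/esym. Qed.

Lemma hdotDl x y z : hdot (x + y) z = hdot x z + hdot y z :> R[i].
Proof. by rewrite -[x]scale1r hdotP mul1r scale1r. Qed.

Lemma hdotZl a x z : hdot (a *: x) z = a * hdot x z.
Proof. by rewrite -[a *: x]addr0 hdotP hdot0l addr0. Qed.

Lemma hdotBl x y z : hdot (x - y) z = hdot x z - hdot y z :> R[i].
Proof. by rewrite hdotDl -scaleN1r hdotZl mulN1r. Qed.

Lemma hdotDr z x y : hdot z (x + y) = hdot z x + hdot z y :> R[i].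
Proof. by rewrite hdotC hdotDl rmorphD /= -!hdotC. Qed.

Lemma hdotBr z x y : hdot z (x - y) = hdot z x - hdot z y :> R[i].
Proof. by rewrite hdotC hdotBl rmorphB /= -!hdotC. Qed.

Lemma hdotZr a z x : hdot z (a *: x) = a^* * hdot z x.
Proof. by rewrite hdotC hdotZl rmorphM /= -hdotC. Qed.

Lemma hdot_eq0 x : hdot x x = 0 -> x = 0.
Proof. by rewrite hdotE => /eqP; rewrite expf_eq0 normr_eq0 => /eqP. Qed.

Lemma hdot_le x y : cabs (hdot x y) <= rnorm x * rnorm y.
Proof.
have C := @dot_cauchy_schwarz _ _ hdot (@hdotP _ H) (@hdotC _ H)
  (fun z => eq_ind_r (fun t => 0 <= t) (exprn_ge0 2 (normr_ge0 z)) (hdotE z))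
  hdot_eq0 x y.
have r0 : 0 <= rnorm x * rnorm y by rewrite mulr_ge0 ?rnorm_ge0.
rewrite -(@ler_pXn2r _ 2)// ?nnegrE ?cabs_ge0// -lecR.
by rewrite exprMn rmorphXn /= -cabsE [leRHS]rmorphM /= !rmorphXn /= -!rnormE -!hdotE.
Qed.

End HdotTheory.

Section Kernels.
Variables (R : realType) (L : zmodType).
Implicit Types (k : L -> L -> R[i]) (w : L -> R) (b d : ell2 R L).

(* The operator with matrix entry k l (l - q) at (l, q). *)
Definition kop k b : ell2 R L := insubd (0 : ell2 R L)
  (fun l => summability.sum (fun m => k l m * b (l - m) : R[i]^o)).

Definition dominated k w (W : R) :=
  (forall l m, cabs (k l m) <= w m) /\
  (forall A : {fset L}, \sum_(m <- A) w m <= W).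

Lemma dominated_ge0 k w W : dominated k w W -> forall m, 0 <= w m.
Proof. by case=> kw _ m; apply: le_trans (kw 0 m); exact: cabs_ge0. Qed.

Lemma dominated_bound_ge0 k w W : dominated k w W -> 0 <= W.
Proof. by case=> _ /(_ fset0); rewrite big_seq_fset0. Qed.

Lemma sum_shift (g : L -> R) (m : L) (A : {fset L}) :
  \sum_(l <- A) g (l - m) = \sum_(l <- [fset (l - m)%R | l in A]%fset) g l.
Proof. by rewrite big_imfset //= => x y _ _ /addIr. Qed.

Lemma ell2_shift_norm b m (A : {fset L}) :
  \sum_(l <- A) cabs (b (l - m)) ^+ 2 <= rnorm b ^+ 2.
Proof. by rewrite (sum_shift (fun l => cabs (b l) ^+ 2)) ell2_sum_le. Qed.

Section Dominated.
Variables (k : L -> L -> R[i]) (w : L -> R) (W : R).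
Hypothesis kw : dominated k w W.

Lemma kop_summable b l : abs_summable (fun m => k l m * b (l - m)).
Proof.
have [kle wle] := kw.
apply: (@abs_summable_le _ _ (fun m => w m * rnorm b) _ (W * rnorm b)) => [m|A].
  by rewrite cabsM ler_pM ?cabs_ge0// ell2_coord_le.
by rewrite -mulr_suml ler_wpM2r ?rnorm_ge0.
Qed.

Fact kop_term_subproof b m :
  (fun l => k l m * b (l - m) : R[i]^o) \in @ell2_pred R L.
Proof.
apply: (@ell2_predP _ _ _ (w m ^+ 2 * rnorm b ^+ 2)) => A.
apply: (@le_trans _ _ (\sum_(l <- A) w m ^+ 2 * cabs (b (l - m)) ^+ 2)).
  apply: ler_sum => l _; rewrite cabsM exprMn ler_wpM2r ?sqr_ge0//.
  by rewrite lerXn2r// ?nnegrE ?cabs_ge0 ?(dominated_ge0 kw)//; case: kw.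
by rewrite -mulr_sumr ler_wpM2l ?sqr_ge0// ell2_shift_norm.
Qed.

Let kop_term b m : ell2 R L := Ell2 (kop_term_subproof b m).

Let kop_term_norm b m : rnorm (kop_term b m) <= w m * rnorm b.
Proof.
apply: ell2_norm_le => [|A]; first by rewrite mulr_ge0 ?rnorm_ge0 ?(dominated_ge0 kw).
apply: (@le_trans _ _ (\sum_(l <- A) w m ^+ 2 * cabs (b (l - m)) ^+ 2)).
  apply: ler_sum => l _; rewrite cabsM exprMn ler_wpM2r ?sqr_ge0//.
  by rewrite lerXn2r// ?nnegrE ?cabs_ge0 ?(dominated_ge0 kw)//; case: kw.
by rewrite exprMn -mulr_sumr ler_wpM2l ?sqr_ge0// ell2_shift_norm.
Qed.

Lemma kop_sum_le b (A : {fset L}) :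
  \sum_(l <- A) cabs (summability.sum (fun m => k l m * b (l - m) : R[i]^o)) ^+ 2
  <= (W * rnorm b) ^+ 2.
Proof.
under eq_bigr do rewrite -[cabs _ ^+ 2]mul1r.
apply: (@sum_bound _ _ _ A (fun l m => k l m * b (l - m)) (fun=> 1)) => [l|B].
  exact: kop_summable.
under eq_bigr do rewrite mul1r.
have E l : \sum_(m <- B) k l m * b (l - m) = (\sum_(m <- B) kop_term b m) l.
  by rewrite ell2_sumE.
under eq_bigr do rewrite E.
apply: le_trans (ell2_sum_le _ _) _; rewrite lerXn2r// ?nnegrE ?rnorm_ge0//.
  by rewrite mulr_ge0 ?rnorm_ge0 ?(dominated_bound_ge0 kw).
apply: le_trans (rnorm_sum _ _) _.
apply: le_trans (ler_sum _ (fun m _ => kop_term_norm b m)) _.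
by rewrite -mulr_suml ler_wpM2r ?rnorm_ge0//; case: kw.
Qed.

Lemma kopE b l :
  kop k b l = summability.sum (fun m => k l m * b (l - m) : R[i]^o).
Proof. by rewrite /kop [ell2_val _]insubdK//; exact: ell2_predP (kop_sum_le b). Qed.

Lemma kop_norm b : rnorm (kop k b) <= W * rnorm b.
Proof.
apply: ell2_norm_le => [|A]; first by rewrite mulr_ge0 ?rnorm_ge0 ?(dominated_bound_ge0 kw).
by under eq_bigr do rewrite kopE; exact: kop_sum_le.
Qed.

Lemma kop_is_linear : linear (kop k).
Proof.
move=> a b d; apply: ell2_inj => l; rewrite ell2_addE ell2_scaleE !kopE.
rewrite -(sum_linear a (kop_summable b l) (kop_summable d l)).
by apply: eq_sum => m; rewrite !ell2E mulrDr mulrCA.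
Qed.

Lemma kop_bounded : bounded_op (kop k).
Proof.
split; first exact: kop_is_linear.
by exists W => b; rewrite rnorm_bound kop_norm.
Qed.

Lemma kop_delta p l : kop k (delta R p) l = k l (l - p).
Proof.
rewrite kopE (@sum_single _ _ (fun m => k l m * delta R p (l - m)) (l - p)).
  by rewrite deltaE subKr eqxx mulr1.
move=> m mp; rewrite deltaE; case: eqP => [E|_]; last by rewrite mulr0.
by rewrite -E subKr eqxx in mp.
Qed.

End Dominated.

Lemma kop_linl (a : R[i]) k k' w w' (W W' : R) : dominated k w W -> dominated k' w' W' ->
  kop (fun l m => a * k l m + k' l m) = (fun b => a *: kop k b + kop k' b).
Proof.
move=> kw kw'; apply/funext => b; apply: ell2_inj => l.
have kw2 : dominated (fun l m => a * k l m + k' l m)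
    (fun m => cabs a * w m + w' m) (cabs a * W + W').
  split=> [l' m|A].
    apply: le_trans (cabsD _ _) _; rewrite cabsM lerD//; last by case: kw'.
    by rewrite ler_wpM2l ?cabs_ge0//; case: kw.
  rewrite big_split /= -mulr_sumr lerD//; last by case: kw'.
  by rewrite ler_wpM2l ?cabs_ge0//; case: kw.
rewrite ell2_addE ell2_scaleE (kopE kw b l) (kopE kw' b l) (kopE kw2 b l).
rewrite -(sum_linear a (kop_summable kw b l) (kop_summable kw' b l)).
by apply: eq_sum => m; rewrite mulrDl mulrA.
Qed.

Lemma kop_mul (g : L -> R) k w (W : R) w' (W' : R) b d :
  dominated k w W ->
  dominated (fun l m => (g l - g (l - m))%:C%C * k l m) w' W' ->
  (forall l, d l = (g l)%:C%C * b l) ->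
  forall l, (g l)%:C%C * kop k b l =
    kop (fun l m => (g l - g (l - m))%:C%C * k l m) b l + kop k d l.
Proof.
set k' := (fun l m => _ * k l m) => kw kw' db l.
rewrite (kopE kw b l) (kopE kw d l) (kopE kw' b l).
rewrite -(sum_scale _ (kop_summable kw b l)).
rewrite -[X in _ = X + _]mul1r.
rewrite -(sum_linear 1 (kop_summable kw' b l) (kop_summable kw d l)).
apply: eq_sum => m.
by rewrite db mul1r /k' rmorphB /=; ring.
Qed.

Lemma dominated_adj k w (W : R) : dominated k w W ->
  dominated (fun l m => (k (l - m) (- m))^*) (fun m => w (- m)) W.
Proof.
case=> kw wW; split=> [l m|A]; first by rewrite cabs_conj.
have <- : \sum_(m <- [fset (- m)%R | m in A]%fset) w m = \sum_(m <- A) w (- m).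
  by rewrite big_imfset //= => x y _ _ /oppr_inj.
exact: wW.
Qed.

Lemma adjoint_pair_delta (S T : ell2 R L -> ell2 R L) :
  bounded_op S -> bounded_op T ->
  (forall p q, S (delta R p) q = (T (delta R q) p)^*) -> adjoint_pair S T.
Proof.
move=> [Sl [M SM]] [Tl [N TN]] ST.
have {}SM b : rnorm (S b) <= M * rnorm b by rewrite -rnorm_bound.
have {}TN b : rnorm (T b) <= N * rnorm b by rewrite -rnorm_bound.
have bnd (y z x : ell2 R L) (Q : R) (U : ell2 R L -> ell2 R L) :
    (forall b, rnorm (U b) <= Q * rnorm b) ->
    rnorm (hdot (U x) y - hdot x z : R[i]^o) <= (Q * rnorm y + rnorm z) * rnorm x.
  move=> UQ; apply: le_trans (rnormD _ _) _; rewrite rnormN mulrDl.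
  apply: lerD; last by rewrite [leRHS]mulrC; exact: hdot_le.
  apply: le_trans (hdot_le _ _) _; rewrite mulrAC.
  by rewrite ler_wpM2r ?rnorm_ge0.
have lin (y z : ell2 R L) (U : ell2 R L -> ell2 R L) : linear U ->
    linear (fun x => hdot (U x) y - hdot x z : R[i]^o).
  by move=> Ul a u v; rewrite Ul !hdotP -[a *: _]/(a * _); ring.
have half q x : hdot (S x) (delta R q) = hdot x (T (delta R q)).
  apply/eqP; rewrite -subr_eq0; apply/eqP.
  move: x; apply: (ell2_ext (lin _ _ _ Sl) (fun x => bnd _ _ x _ _ SM)) => p.
  by rewrite hdot_delta ST hdotC hdot_delta subrr.
move=> x y; rewrite [LHS]hdotC [RHS]hdotC; congr (_^*).
apply/eqP; rewrite eq_sym -subr_eq0; apply/eqP; move: y.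
apply: (ell2_ext (lin _ _ _ Tl) (fun y => bnd _ _ y _ _ TN)) => q.
by rewrite [hdot (T _) _]hdotC -half [X in _ - X]hdotC subrr.
Qed.

Lemma kop_adj k w (W : R) : dominated k w W ->
  adjoint_pair (kop k) (kop (fun l m => (k (l - m) (- m))^*)).
Proof.
move=> kw; have kw' := dominated_adj kw.
apply: adjoint_pair_delta; [exact: kop_bounded kw|exact: kop_bounded kw'|].
move=> p q; rewrite (kop_delta kw) (kop_delta kw') conjCK subKr opprB.
by [].
Qed.

End Kernels.

Section OperatorClosure.
Variables (R : realType) (H : hilbertType R[i]).
Implicit Types (S T U : H -> H) (x y z : H).

Lemma bounded_opP T : bounded_op T <->
  linear T /\ exists2 M : R, 0 <= M & forall x, rnorm (T x) <= M * rnorm x.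
Proof.
split=> [[Tl [M TM]]|[Tl [M M0 TM]]]; split=> //; last first.
  by exists M => x; rewrite rnorm_bound.
exists `|M| => // x; apply: (@le_trans _ _ (M * rnorm x)).
  by rewrite -rnorm_bound.
by rewrite ler_wpM2r ?rnorm_ge0// ler_norm.
Qed.

Lemma linear_sub T x y : linear T -> T (x - y) = T x - T y.
Proof. by move=> Tl; have := Tl (-1) y x; rewrite !scaleN1r [- y + x]addrC [- T y + _]addrC. Qed.

Lemma rnormZ (a : R[i]) x : rnorm (a *: x) = cabs a * rnorm x.
Proof. by apply: complexI; rewrite rmorphM /= -rnormE -cabsE normrZ rnormE. Qed.

Lemma bounded_lin (a : R[i]) S T : bounded_op S -> bounded_op T ->
  bounded_op (fun x => a *: S x + T x).
Proof.
move=> /bounded_opP[Sl [M M0 SM]] /bounded_opP[Tl [N N0 TN]]; apply/bounded_opP; split.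
  by move=> b x y; rewrite Sl Tl !scalerDr !scalerA (mulrC b) addrACA.
exists (cabs a * M + N); first by rewrite addr_ge0 ?mulr_ge0 ?cabs_ge0.
move=> x; apply: le_trans (rnormD _ _) _; rewrite rnormZ mulrDl -mulrA lerD//.
by rewrite ler_wpM2l ?cabs_ge0.
Qed.

Lemma bounded_comp S T : bounded_op S -> bounded_op T -> bounded_op (S \o T).
Proof.
move=> /bounded_opP[Sl [M M0 SM]] /bounded_opP[Tl [N N0 TN]]; apply/bounded_opP; split.
  by move=> b x y; rewrite /= Tl Sl.
exists (M * N); first by rewrite mulr_ge0.
by move=> x; apply: le_trans (SM _) _; rewrite -mulrA ler_wpM2l.
Qed.

Lemma hdot_inj x y : (forall z, hdot z x = hdot z y :> R[i]) -> x = y.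
Proof.
by move=> /(_ (x - y)) E; apply/subr0_eq/hdot_eq0; rewrite hdotBr E subrr.
Qed.

Lemma adjoint_linear S T : adjoint_pair S T -> linear T.
Proof.
by move=> ST a x y; apply: hdot_inj => z; rewrite -ST !hdotDr !hdotZr !ST.
Qed.

Lemma adjoint_norm S T (M : R) : adjoint_pair S T -> 0 <= M ->
  (forall x, rnorm (S x) <= M * rnorm x) -> forall y, rnorm (T y) <= M * rnorm y.
Proof.
move=> ST M0 SM y; have [->|y0] := eqVneq (rnorm (T y)) 0.
  by rewrite mulr_ge0 ?rnorm_ge0.
have Tgt0 : 0 < rnorm (T y) by rewrite lt_def y0 rnorm_ge0.
rewrite -(ler_pM2r Tgt0).
have -> : rnorm (T y) * rnorm (T y) = cabs (hdot (T y) (T y)).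
  by apply: complexI; rewrite -cabsE hdotE rmorphM /= -rnormE -expr2 ger0_norm ?exprn_ge0.
rewrite -ST; apply: le_trans (hdot_le _ _) _; rewrite mulrAC.
by rewrite ler_wpM2r ?rnorm_ge0.
Qed.

Lemma invS_small (e : R) : 0 < e -> exists n : nat, n.+1%:R^-1 <= e.
Proof.
move=> e0; have [n _ Hn] := near_infty_natSinv_lt (PosNum e0).
by exists n; apply/ltW/(Hn n) => /=.
Qed.

Lemma le0_invS (x M : R) : (forall n : nat, x <= M * n.+1%:R^-1) -> x <= 0.
Proof.
move=> xM; apply: (@le0_eps _ _ `|M|) => e /invS_small[n ne].
apply: le_trans (xM n) _; apply: le_trans (ler_norm _) _.
by rewrite normrM [ `|_^-1| ]ger0_norm ?invr_ge0// ler_wpM2l.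
Qed.

Lemma cauchy_invS (u : nat -> H) (M : R) :
  (forall n m, rnorm (u n - u m) <= M * (n.+1%:R^-1 + m.+1%:R^-1)) ->
  exists t, forall n, rnorm (t - u n) <= M * n.+1%:R^-1.
Proof.
move=> uM.
have M0 : 0 <= M by have := uM 0 0; rewrite subrr rnorm0 invr1; lra.
have /cvg_ex[t /cvgrPdist_le ut] : cvg (u @ \oo).
  apply: cauchy_cvg; apply: cauchy_exP => e /gtc0P[r r0 ->].
  have r20 : 0 < r / (2 * M + 1).
    by rewrite divr_gt0//; lra.
  have [N HN] := invS_small r20.
  exists (u N); exists N => // n /= Nn.
  rewrite -ball_normE /= rnormE ltcR; apply: le_lt_trans (uM N n) _.
  have nN : n.+1%:R^-1 <= N.+1%:R^-1 :> R by rewrite lef_pV2 ?posrE ?ler_nat.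
  apply: (@le_lt_trans _ _ (M * (r / (2 * M + 1) + r / (2 * M + 1)))).
    by rewrite ler_wpM2l// lerD// (le_trans nN).
  rewrite -mulrDl mulrA ltr_pdivrMr; last lra.
  by nra.
exists t => n; rewrite -subr_le0; apply: (@le0_invS _ (1 + M)) => m.
have m0 : 0 < (m.+1%:R^-1 : R) by rewrite invr_gt0.
have /ut [N _ HN] : 0 < (m.+1%:R^-1 : R)%:C%C by rewrite ltcR.
have := HN (maxn N m) (leq_maxl _ _); rewrite -rnorm_le => tu.
have km : (maxn N m).+1%:R^-1 <= m.+1%:R^-1 :> R.
  by rewrite lef_pV2 ?posrE// ler_nat ltnS leq_maxr.
rewrite lerBlDr -[t - u n](_ : t - u (maxn N m) + (u (maxn N m) - u n) = _); last first.
  by rewrite addrA subrK.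
apply: le_trans (rnormD _ _) _; apply: le_trans (lerD tu (uM _ _)) _.
rewrite mulrDl mul1r mulrDr addrA lerD2r lerD2l.
by rewrite ler_wpM2l.
Qed.

Variable A : set (H -> H).
Hypothesis Astar : star_algebra_of_ops A.

Lemma op_closureP T : op_closure A T <-> bounded_op T /\
  forall e : R, 0 < e -> exists2 S, A S & forall x, rnorm (T x - S x) <= e * rnorm x.
Proof.
by split=> -[Tb Te]; split=> // e /Te[S AS TS]; exists S => // x;
  have := TS x; rewrite rnorm_bound.
Qed.

Lemma sub_op_closure : A `<=` op_closure A.
Proof.
move=> T AT; apply/op_closureP; split; first exact: star_alg_bounded AT.
move=> e e0; exists T => // x; rewrite subrr rnorm0.
by rewrite mulr_ge0 ?rnorm_ge0 ?ltW.
Qed.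

Let closure_lin (a : R[i]) S T : op_closure A S -> op_closure A T ->
  op_closure A (fun x => a *: S x + T x).
Proof.
move=> /op_closureP[Sb Se] /op_closureP[Tb Te]; apply/op_closureP.
split=> [|e e0]; first exact: bounded_lin.
have a0 := cabs_ge0 a.
have [|S' AS' SS'] := Se (e / (2 * (cabs a + 1))).
  by rewrite divr_gt0// mulr_gt0//; lra.
have [|T' AT' TT'] := Te (e / 2); first by rewrite divr_gt0.
exists (fun x => a *: S' x + T' x); first exact: star_alg_lin.
move=> x; rewrite opprD addrACA -scalerBr; apply: le_trans (rnormD _ _) _.
rewrite rnormZ; apply: le_trans (lerD (ler_wpM2l a0 (SS' x)) (TT' x)) _.
rewrite mulrA -mulrDl ler_wpM2r ?rnorm_ge0//.
rewrite [leRHS]splitr lerD2r mulrA ler_pdivrMr; last by rewrite mulr_gt0//; lra.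
have -> : e / 2 * (2 * (cabs a + 1)) = cabs a * e + e by field.
by lra.
Qed.

Let closure_comp S T : op_closure A S -> op_closure A T -> op_closure A (S \o T).
Proof.
move=> /op_closureP[Sb Se] /op_closureP[Tb Te]; apply/op_closureP.
split=> [|e e0]; first exact: bounded_comp.
have /bounded_opP[Sl [M M0 SM]] := Sb.
have [|T' AT' TT'] := Te (e / (2 * (M + 1))).
  by rewrite divr_gt0// mulr_gt0//; lra.
have /bounded_opP[_ [N N0 TN]] := star_alg_bounded Astar AT'.
have [|S' AS' SS'] := Se (e / (2 * (N + 1))).
  by rewrite divr_gt0// mulr_gt0//; lra.
exists (S' \o T'); first exact: star_alg_comp.
move=> x /=; rewrite -[S (T x) - _](_ : S (T x - T' x) + (S (T' x) - S' (T' x)) = _); last first.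
  by rewrite (linear_sub _ _ Sl) addrA subrK.
apply: le_trans (rnormD _ _) _.
have h (Q : R) : 0 <= Q -> Q * (e / (2 * (Q + 1))) <= e / 2.
  move=> Q0; rewrite mulrA ler_pdivrMr; last by rewrite mulr_gt0//; lra.
  have -> : e / 2 * (2 * (Q + 1)) = Q * e + e by field.
  by lra.
rewrite [e in leRHS]splitr mulrDl; apply: lerD.
  apply: le_trans (SM _) _; apply: le_trans (ler_wpM2l M0 (TT' x)) _.
  by rewrite mulrA ler_wpM2r ?rnorm_ge0 ?h.
have eN0 : 0 <= e / (2 * (N + 1)) by rewrite divr_ge0 ?mulr_ge0//; lra.
apply: le_trans (SS' _) _; apply: le_trans (ler_wpM2l eN0 (TN x)) _.
by rewrite mulrA ler_wpM2r ?rnorm_ge0// mulrC h.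
Qed.

(* The adjoint of a norm limit is the limit of the adjoints. *)
Let closure_adj T : op_closure A T -> exists2 S, op_closure A S & adjoint_pair T S.
Proof.
move=> /op_closureP[Tb Te].
have /choice[S SP] : forall n : nat, exists S, A S /\
    forall x, rnorm (T x - S x) <= n.+1%:R^-1 * rnorm x.
  by move=> n; have [|S AS TS] := Te n.+1%:R^-1; [rewrite invr_gt0|exists S].
have /choice[S' S'P] : forall n : nat, exists S', A S' /\ adjoint_pair (S n) S'.
  by move=> n; have [AS _] := SP n; have [S' ? ?] := star_alg_adj Astar AS; exists S'.
have inv0 n : 0 <= n.+1%:R^-1 :> R by rewrite invr_ge0.
have S'C n m y : rnorm (S' n y - S' m y) <= rnorm y * (n.+1%:R^-1 + m.+1%:R^-1).
  rewrite [leRHS]mulrC.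
  apply: (@adjoint_norm (fun x => S n x - S m x) (fun x => S' n x - S' m x)).
  - by move=> x z; rewrite hdotBl hdotBr (S'P n).2 (S'P m).2.
  - exact: addr_ge0.
  move=> x; rewrite -[S n x - S m x](_ : - (T x - S n x) + (T x - S m x) = _); last first.
    by rewrite opprB addrA subrK.
  apply: le_trans (rnormD _ _) _; rewrite rnormN mulrDl.
  by rewrite lerD// ?(SP n).2 ?(SP m).2.
have /choice[T' T'P] : forall y, exists t, forall n,
    rnorm (t - S' n y) <= rnorm y * n.+1%:R^-1.
  by move=> y; apply: cauchy_invS => n m; exact: S'C.
have TT' : adjoint_pair T T'.
  move=> x y; apply/subr0_eq/cabs_eq0/le_anti; rewrite cabs_ge0 andbT.
  apply: (@le0_invS _ (2 * (rnorm x * rnorm y))) => n.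
  rewrite -[hdot (T x) y - _](_ : hdot (T x - S n x) y + hdot x (S' n y - T' y) = _).
    apply: le_trans (cabsD _ _) _.
    have := T'P y n; rewrite -rnormN opprB => T'n.
    have := lerD (hdot_le (T x - S n x) y) (hdot_le x (S' n y - T' y)).
    have := ler_wpM2r (rnorm_ge0 y) ((SP n).2 x).
    have := ler_wpM2l (rnorm_ge0 x) T'n.
    move: (cabs _ + cabs _) (rnorm _ * rnorm y) (rnorm x * rnorm _) n.+1%:R^-1.
    move: (rnorm x) (rnorm y) => p q s1 s2 s3 s4.
    have -> : p * (q * s4) = p * q * s4 by ring.
    have -> : s4 * p * q = p * q * s4 by ring.
    have -> : 2 * (p * q) * s4 = 2 * (p * q * s4) by ring.
    by move: (p * q * s4) => t; lra.
  by rewrite hdotBl hdotBr (S'P n).2 addrA subrK.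
have /bounded_opP[_ [M M0 TM]] := Tb.
exists T' => //; apply/op_closureP; split.
  apply/bounded_opP; split; first exact: adjoint_linear TT'.
  by exists M => //; exact: adjoint_norm TT' M0 TM.
move=> e /invS_small[n ne]; exists (S' n); first exact: (S'P n).1.
by move=> y; apply: le_trans (T'P y n) _; rewrite mulrC ler_wpM2r ?rnorm_ge0.
Qed.

Lemma star_algebra_closure : star_algebra_of_ops (op_closure A).
Proof.
split.
- by move=> T [].
- by apply: sub_op_closure; exact: star_alg0.
- exact: closure_lin.
- exact: closure_comp.
- exact: closure_adj.
Qed.

Lemma op_closure_closed : op_closure (op_closure A) `<=` op_closure A.
Proof.
move=> T [Tb Te]; apply/op_closureP; split=> // e e0.
have e20 : 0 < e / 2 by rewrite divr_gt0.
have [S /op_closureP[_ Se] TS] := Te _ e20; have [U AU SU] := Se _ e20.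
exists U => // x; rewrite -[T x - U x](_ : (T x - S x) + (S x - U x) = _); last first.
  by rewrite addrA subrK.
apply: le_trans (rnormD _ _) _; rewrite [e in leRHS]splitr mulrDl lerD//.
by rewrite -rnorm_bound.
Qed.

Lemma cstar_algebra_closure : cstar_algebra (op_closure A).
Proof. by split; [exact: star_algebra_closure|exact: op_closure_closed]. Qed.

End OperatorClosure.

Section DiagonalRepresentation.
Variables (R : realType) (L : zmodType).
Local Notation H2 := (hsum (ell2 R L) (ell2 R L)).
Implicit Types (S T : ell2 R L -> ell2 R L) (x y : H2).

Lemma hsum_rnormE x : rnorm x ^+ 2 = rnorm x.1 ^+ 2 + rnorm x.2 ^+ 2.
Proof. by apply: complexI; rewrite rmorphD !rmorphXn /= -!rnormE hsum_normE. Qed.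

Lemma hsum_rnorm_le x y (M : R) : 0 <= M ->
  rnorm x.1 <= M * rnorm y.1 -> rnorm x.2 <= M * rnorm y.2 -> rnorm x <= M * rnorm y.
Proof.
move=> M0 h1 h2.
rewrite -(@ler_pXn2r _ 2)// ?nnegrE ?mulr_ge0 ?rnorm_ge0//.
rewrite exprMn !hsum_rnormE mulrDr -!exprMn.
by rewrite lerD// lerXn2r// ?nnegrE ?mulr_ge0 ?rnorm_ge0.
Qed.

Lemma diag_rep_bounded T : bounded_op T -> bounded_op (diag_rep T).
Proof.
move=> /bounded_opP[Tl [M M0 TM]]; apply/bounded_opP; split.
  by move=> a x y; rewrite /diag_rep /= !Tl.
by exists M => // x; apply: hsum_rnorm_le => //=.
Qed.

Lemma diag_rep_adjoint S T : adjoint_pair S T -> adjoint_pair (diag_rep S) (diag_rep T).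
Proof. by move=> ST x y; rewrite -[LHS]/(hdot _ _ + hdot _ _) !ST. Qed.

Lemma diag_rep_star_representation (A : set (ell2 R L -> ell2 R L)) :
  star_algebra_of_ops A -> star_representation A (@diag_rep R L).
Proof.
move=> Astar; split.
- by move=> T AT; apply: diag_rep_bounded; exact: star_alg_bounded AT.
- by move=> a S T _ _; apply/funext => -[x y].
- by move=> S T _ _; apply/funext => -[x y].
- by move=> S T _ _; exact: diag_rep_adjoint.
Qed.

End DiagonalRepresentation.

Lemma cabs_sum (R : realType) (T : Type) (s : seq T) (x : T -> R[i]) :
  cabs (\sum_(i <- s) x i) <= \sum_(i <- s) cabs (x i).
Proof.
elim: s => [|i s IH]; first by rewrite !big_nil /cabs normr0.
by rewrite !big_cons; apply: le_trans (cabsD _ _) _; rewrite lerD2l.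
Qed.

Section TwistedConvolution.
Variables (R : realType) (L : zmodType) (c : L -> L -> R[i]).
Hypothesis c_unit : forall x y, `|c x y| = 1.
Hypothesis cDl : forall x y z, c (x + y) z = c x z * c y z.
Hypothesis cDr : forall x y z, c z (x + y) = c z x * c z y.
Implicit Types a b : L -> R[i].

Lemma cabs_cocycle x y : cabs (c x y) = 1.
Proof. by rewrite /cabs c_unit. Qed.

Let c_neq0 x y : c x y != 0.
Proof. by rewrite -normr_eq0 c_unit oner_neq0. Qed.

Lemma cocycle0l y : c 0 y = 1.
Proof. by apply: (mulfI (c_neq0 0 y)); rewrite -cDl addr0 mulr1. Qed.

Lemma cocycle0r x : c x 0 = 1.
Proof. by apply: (mulfI (c_neq0 x 0)); rewrite -cDr addr0 mulr1. Qed.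

Let c_conj x y : c x y * (c x y)^* = 1.
Proof. by rewrite -normCK c_unit expr1n. Qed.

Lemma cocycleNl x y : c (- x) y = (c x y)^*.
Proof. by apply: (mulfI (c_neq0 x y)); rewrite -cDl subrr cocycle0l c_conj. Qed.

Lemma cocycleNr x y : c x (- y) = (c x y)^*.
Proof. by apply: (mulfI (c_neq0 x y)); rewrite -cDr subrr cocycle0r c_conj. Qed.

Lemma ell1P a : ell1 a <-> abs_summable a.
Proof. by apply: esum_ltP => l; exact: cabs_ge0. Qed.

Definition conv_kernel a l m := a m * c m (l - m).

Lemma lconvE a : lconv c a = kop (conv_kernel a).
Proof.
apply/funext => b; rewrite /lconv /kop; congr insubd; apply/funext => l.
by apply: eq_sum => m; rewrite mulrAC.
Qed.

Lemma cabs_conv_kernel a l m : cabs (conv_kernel a l m) = cabs (a m).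
Proof. by rewrite cabsM cabs_cocycle mulr1. Qed.

Lemma conv_kernel_dominated a (M : R) : (forall A : {fset L}, \sum_(l <- A) cabs (a l) <= M) ->
  dominated (conv_kernel a) (fun m => cabs (a m)) M.
Proof. by move=> aM; split=> // l m; rewrite cabs_conv_kernel. Qed.

Lemma lconv_bounded a : ell1 a -> bounded_op (lconv c a).
Proof. by move=> /ell1P[M /conv_kernel_dominated aM]; rewrite lconvE; exact: kop_bounded aM. Qed.

Lemma lconv_delta a p l : ell1 a -> lconv c a (delta R p) l = a (l - p) * c (l - p) p.
Proof.
move=> /ell1P[M /conv_kernel_dominated aM].
by rewrite lconvE (kop_delta aM) /conv_kernel subKr.
Qed.

Lemma lconv_ell1_lin x a b : ell1 a -> ell1 b ->
  lconv c (fun l => x * a l + b l) = (fun d => x *: lconv c a d + lconv c b d).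
Proof.
move=> /ell1P[M /conv_kernel_dominated aM] /ell1P[N /conv_kernel_dominated bN].
rewrite !lconvE -(kop_linl x aM bN); congr kop.
by apply/funext => l; apply/funext => m; rewrite /conv_kernel mulrDl mulrA.
Qed.

Lemma tstar_conv_kernel a : conv_kernel (tstar c a) = (fun l m => (conv_kernel a (l - m) (- m))^*).
Proof.
apply/funext => l; apply/funext => m; rewrite /conv_kernel /tstar opprK subrK rmorphM /=.
rewrite cocycleNl conjCK cDr cocycleNr.
by rewrite -[RHS]mul1r -(c_conj m m); ring.
Qed.

Lemma lconv_tstar a : ell1 a -> adjoint_pair (lconv c a) (lconv c (tstar c a)).
Proof.
by move=> /ell1P[M /conv_kernel_dominated aM]; rewrite !lconvE tstar_conv_kernel; exact: kop_adj aM.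
Qed.

Lemma lconv_injective a b : ell1 a -> ell1 b -> lconv c a = lconv c b -> a = b.
Proof.
move=> a1 b1 E; apply/funext => l.
have : lconv c a (delta R 0) l = lconv c b (delta R 0) l by rewrite E.
by rewrite !lconv_delta// !subr0 cocycle0r !mulr1.
Qed.

Lemma tconv_summable a b l : ell1 a -> ell1 b ->
  abs_summable (fun m => a m * b (l - m) * c m (l - m)).
Proof.
move=> /ell1P[M aM] /ell1P[N bN].
have N0 : 0 <= N by have := bN fset0; rewrite big_seq_fset0.
apply: (@abs_summable_le _ _ (fun m => cabs (a m) * N) _ (M * N)) => [m|A].
  rewrite !cabsM cabs_cocycle mulr1 ler_wpM2l ?cabs_ge0//.
  by have := bN [fset (l - m)]%fset; rewrite big_seq_fset1.
by rewrite -mulr_suml ler_wpM2r.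
Qed.

Lemma tconv_bound (w : L -> R) a b (M N : R) : ell1 a -> ell1 b ->
  (forall l, 0 <= w l) -> (forall l m, w (l + m) <= w l * w m) ->
  (forall A : {fset L}, \sum_(l <- A) cabs (a l) * w l <= M) ->
  (forall A : {fset L}, \sum_(l <- A) cabs (b l) * w l <= N) ->
  forall A : {fset L}, \sum_(l <- A) cabs (tconv c a b l) * w l <= M * N.
Proof.
move=> a1 b1 w0 wM aM bN A.
have N0 : 0 <= N by have := bN fset0; rewrite big_seq_fset0.
under eq_bigr do rewrite mulrC -[cabs _]expr1.
apply: (@sum_bound _ _ _ A (fun l m => a m * b (l - m) * c m (l - m)) w 1 _
  (fun l => tconv_summable l a1 b1)) => B.
apply: (@le_trans _ _ (\sum_(l <- A) \sum_(m <- B)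
    (cabs (a m) * w m) * (cabs (b (l - m)) * w (l - m)))).
  apply: ler_sum => l _; rewrite expr1.
  apply: le_trans (ler_wpM2l (w0 l) (cabs_sum _ _)) _.
  rewrite mulr_sumr; apply: ler_sum => m _.
  rewrite !cabsM cabs_cocycle mulr1 mulrC mulrACA ler_wpM2l ?mulr_ge0 ?cabs_ge0//.
  by have := wM m (l - m); rewrite addrC subrK.
rewrite exchange_big /=.
apply: (@le_trans _ _ (\sum_(m <- B) cabs (a m) * w m * N)).
  apply: ler_sum => m _; rewrite -mulr_sumr ler_wpM2l ?mulr_ge0 ?cabs_ge0//.
  by rewrite (sum_shift (fun l => cabs (b l) * w l)).
by rewrite -mulr_suml ler_wpM2r.
Qed.

Lemma tconv_ell1 a b : ell1 a -> ell1 b -> ell1 (tconv c a b).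
Proof.
move=> a1 b1; have /ell1P[M aM] := a1; have /ell1P[N bN] := b1.
apply/ell1P; exists (M * N) => A; under eq_bigr do rewrite -[cabs _]mulr1.
apply: (@tconv_bound (fun=> 1)) => //; first by move=> l m; rewrite mulr1.
  by move=> B; under eq_bigr do rewrite mulr1.
by move=> B; under eq_bigr do rewrite mulr1.
Qed.

(* Both sides are bounded, so it suffices to compare them on the vectors delta p,
   where the claim is the cocycle identity. *)
Lemma lconv_tconv a b : ell1 a -> ell1 b ->
  lconv c (tconv c a b) = lconv c a \o lconv c b.
Proof.
move=> a1 b1; have ab1 := tconv_ell1 a1 b1.
have Ub : bounded_op (fun d => (-1) *: lconv c (tconv c a b) d + (lconv c a \o lconv c b) d).
  apply: bounded_lin; first exact: lconv_bounded.
  by apply: bounded_comp; exact: lconv_bounded.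
have /bounded_opP[Ul [M _ UM]] := Ub.
suff E d : (-1) *: lconv c (tconv c a b) d + (lconv c a \o lconv c b) d = 0.
  by apply/funext => d; have := E d; rewrite scaleN1r addrC => /subr0_eq ->.
move: d; apply: (ell2_ext Ul UM) => p; rewrite scaleN1r addrC.
apply/eqP; rewrite subr_eq0 eq_sym; apply/eqP.
apply: ell2_inj => l; rewrite lconv_delta// /= [in RHS]lconvE.
have /ell1P[N /conv_kernel_dominated aN] := a1.
rewrite (kopE aN) mulrC /tconv.
rewrite -(sum_scale _ (tconv_summable (l - p) a1 b1)).
apply: eq_sum => m; rewrite lconv_delta// /conv_kernel.
have -> : l - p - m = l - m - p by rewrite addrAC.
set q := l - m - p.
have -> : l - p = m + q by rewrite /q addrA [m + _]addrC subrK.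
have -> : l - m = q + p by rewrite /q subrK.
by rewrite cDl cDr; ring.
Qed.

End TwistedConvolution.

Section WeightedAlgebras.
Variables (R : realType) (L : zmodType) (c : L -> L -> R[i]).
Hypothesis c_unit : forall x y, `|c x y| = 1.
Hypothesis cDl : forall x y z, c (x + y) z = c x z * c y z.
Hypothesis cDr : forall x y z, c z (x + y) = c z x * c z y.
Implicit Types (a b : L -> R[i]) (w : L -> R).

Lemma ell1wP w a : (forall l, 0 <= w l) -> ell1w w a <->
  ell1 a /\ exists M, forall A : {fset L}, \sum_(l <- A) cabs (a l) * w l <= M.
Proof.
move=> w0; have aw0 l : 0 <= cabs (a l) * w l by rewrite mulr_ge0 ?cabs_ge0.
by split=> -[a1 aw]; split=> //; [apply/esum_ltP|apply/(esum_ltP aw0)].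
Qed.

Lemma ell1w1 : ell1w (fun=> 1) = @ell1 R L.
Proof.
apply/seteqP; split=> [a []//|a a1]; apply/ell1wP => //; split=> //.
have /ell1P[M aM] := a1; exists M => A; under eq_bigr do rewrite mulr1.
exact: aM.
Qed.

Variable w : L -> R.
Hypothesis w_ge0 : forall l, 0 <= w l.
Hypothesis wM : forall l m, w (l + m) <= w l * w m.
Hypothesis wN : forall l, w (- l) = w l.

Lemma star_embedding_ell1w : star_embedding c (ell1w w).
Proof.
have sumN (g : L -> R) (A : {fset L}) :
    \sum_(l <- A) g (- l) = \sum_(l <- [fset (- l)%R | l in A]%fset) g l.
  by rewrite big_imfset //= => x y _ _ /oppr_inj.
split.
- move=> x a b /(ell1wP _ w_ge0)[/ell1P[M aM] [M' aM']].
  move=> /(ell1wP _ w_ge0)[/ell1P[N bN] [N' bN']].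
  have x0 := cabs_ge0 x.
  apply/(ell1wP _ w_ge0); split.
    apply/ell1P; exists (cabs x * M + N) => A.
    apply: (@le_trans _ _ (\sum_(l <- A) (cabs x * cabs (a l) + cabs (b l)))).
      by apply: ler_sum => l _; rewrite -cabsM cabsD.
    by rewrite big_split -mulr_sumr /= lerD// ler_wpM2l.
  exists (cabs x * M' + N') => A.
  apply: (@le_trans _ _ (\sum_(l <- A) (cabs x * (cabs (a l) * w l) + cabs (b l) * w l))).
    by apply: ler_sum => l _; rewrite mulrA -mulrDl ler_wpM2r// -cabsM cabsD.
  by rewrite big_split -mulr_sumr /= lerD// ler_wpM2l.
- move=> a b /(ell1wP _ w_ge0)[a1 [M aM]] /(ell1wP _ w_ge0)[b1 [N bN]].
  apply/(ell1wP _ w_ge0); split; first exact: tconv_ell1.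
  by exists (M * N); apply: tconv_bound.
- move=> a /(ell1wP _ w_ge0)[/ell1P[M aM] [M' aM']].
  have sE l : cabs (tstar c a l) = cabs (a (- l)).
    by rewrite /tstar cabsM (cabs_cocycle c_unit) mul1r cabs_conj.
  apply/(ell1wP _ w_ge0); split.
    apply/ell1P; exists M => A; under eq_bigr do rewrite sE.
    by rewrite (sumN (fun l => cabs (a l))).
  exists M' => A; under eq_bigr do rewrite sE -wN.
  by rewrite (sumN (fun l => cabs (a l) * w l)).
- by move=> x a b [a1 _] [b1 _]; exact: lconv_ell1_lin.
- by move=> a b [a1 _] [b1 _]; exact: lconv_tconv.
- by move=> a [a1 _]; exact: lconv_tstar.
- by move=> a b [a1 _] [b1 _]; exact: lconv_injective.
Qed.

Lemma star_algebra_ell1w : star_algebra_of_ops [set lconv c a | a in ell1w w].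
Proof.
have E := star_embedding_ell1w.
have z1 : ell1w w ((fun=> 0) : L -> R[i]).
  have c0 : cabs (0 : R[i]) = 0 by rewrite /cabs normr0.
  apply/(ell1wP _ w_ge0); split; first apply/ell1P; exists 0 => A; rewrite big1//.
  by move=> i _; rewrite c0 mul0r.
split.
- by move=> _ [a [a1 _] <-]; exact: lconv_bounded.
- exists ((fun=> 0) : L -> R[i]) => //.
  have := lconv_lin E (-1) z1 z1.
  have -> : (fun l : L => -1 * 0 + 0 : R[i]) = fun=> 0.
    by apply/funext => l; rewrite mulr0 addr0.
  by move=> ->; apply/funext => d; rewrite scaleN1r addNr.
- move=> x _ _ [a aw <-] [b bw <-]; rewrite -(lconv_lin E)//.
  by exists (fun l => x * a l + b l) => //; exact: (star_emb_lin E).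
- move=> _ _ [a aw <-] [b bw <-]; rewrite -(lconv_conv E)//.
  by exists (tconv c a b) => //; exact: (star_emb_conv E).
- move=> _ [a aw <-]; exists (lconv c (tstar c a)); last exact: lconv_star E _ aw.
  by exists (tstar c a) => //; exact: (star_emb_star E).
Qed.

(* Finitely supported functions lie in every weighted algebra, and truncation
   converges in ell^1, which dominates the operator norm. *)
Lemma lconv_ell1_closure a : ell1 a -> op_closure [set lconv c b | b in ell1w w] (lconv c a).
Proof.
move=> a1; apply/op_closureP; split; first exact: lconv_bounded.
move=> e e0; have /ell1P[M aM] := a1.
have [A HA] := sum_tail (fun l => cabs_ge0 (a l)) aM e0.
pose t l := if l \in A then 0 else a l.
have tE l : cabs (t l) = if l \in A then 0 else cabs (a l).
  by rewrite /t; case: ifP => // _; rewrite /cabs normr0.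
have tM (B : {fset L}) : \sum_(l <- B) cabs (t l) <= e.
  by under eq_bigr do rewrite tE; exact: HA.
have t1 : ell1 t by apply/ell1P; exists e.
pose b l := -1 * t l + a l.
have bE l : cabs (b l) = if l \in A then cabs (a l) else 0.
  rewrite /b /t; case: ifP => _; first by rewrite mulr0 add0r.
  by rewrite mulN1r addNr /cabs normr0.
have bg0 (g : L -> R) : (forall l, 0 <= g l) -> forall B : {fset L},
    \sum_(l <- B) cabs (b l) * g l <= \sum_(l <- A) cabs (a l) * g l.
  move=> g0 B; have bg l : 0 <= cabs (b l) * g l by rewrite mulr_ge0 ?cabs_ge0.
  apply: le_trans (ler_sum_fsubset bg (fsubsetUr A B)) _.
  rewrite -(sum_fsetU_mem _ A B).
  rewrite [leRHS]big_mkcond; apply: ler_sum => l _; rewrite bE.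
  by case: ifP => _//; rewrite mul0r.
have bw : ell1w w b.
  apply/(ell1wP _ w_ge0); split; last by eexists; exact: bg0.
  apply/ell1P; exists (\sum_(l <- A) cabs (a l) * 1) => B.
  by apply: le_trans (bg0 (fun=> 1) (fun=> ler01) B); under [leRHS]eq_bigr do rewrite mulr1.
exists (lconv c b); first by exists b.
move=> x; rewrite /b lconv_ell1_lin// scaleN1r opprD opprK addrCA subrr addr0.
rewrite lconvE; apply: kop_norm; exact: conv_kernel_dominated.
Qed.

End WeightedAlgebras.

Section TwistedCstar.
Variables (R : realType) (L : zmodType) (c : L -> L -> R[i]).
Hypothesis c_unit : forall x y, `|c x y| = 1.
Hypothesis cDl : forall x y z, c (x + y) z = c x z * c y z.
Hypothesis cDr : forall x y z, c z (x + y) = c z x * c z y.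

Lemma star_algebra_ell1 : star_algebra_of_ops [set lconv c a | a in @ell1 R L].
Proof.
rewrite -ell1w1; apply: star_algebra_ell1w => //.
by move=> l m; rewrite mulr1.
Qed.

Lemma twisted_cstar_algebra : cstar_algebra (twisted_cstar c).
Proof. exact: cstar_algebra_closure star_algebra_ell1. Qed.

Lemma twisted_cstar_dense (w : L -> R) : (forall l, 0 <= w l) ->
  (forall l m, w (l + m) <= w l * w m) -> (forall l, w (- l) = w l) ->
  dense_star_subalgebra (twisted_cstar c) [set lconv c a | a in ell1w w].
Proof.
move=> w0 wM wN; split; first exact: star_algebra_ell1w.
  by move=> _ [a [a1 _] <-]; apply: (sub_op_closure star_algebra_ell1); exists a.
move=> T [Tb Te]; apply: op_closure_closed; split=> // e /Te[S [a a1 <-] TS].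
by exists (lconv c a); [exact: lconv_ell1_closure|exact: TS].
Qed.

End TwistedCstar.

Section DiagonalOperators.
Variables (R : realType) (L : zmodType).
Local Notation E2 := (ell2 R L).
Local Notation H2 := (hsum E2 E2).
Implicit Types S T : set (E2 * E2).

Lemma diag_op_operator S T : is_operator S -> is_operator T -> is_operator (diag_op S T).
Proof.
move=> [S0 Sl Sf] [T0 Tl Tf]; split=> //.
- by move=> a x y x' y' [? ?] [? ?]; split=> /=; [exact: Sl|exact: Tl].
move=> [x1 x2] [y1 y2] [y1' y2'] [/= Sy Ty] [/= Sy' Ty'].
by rewrite (Sf _ _ _ Sy Sy') (Tf _ _ _ Ty Ty').
Qed.

Lemma diag_op_adjoint S T : S (0, 0) -> T (0, 0) ->
  op_adjoint (diag_op S T : set (H2 * H2)) = diag_op (op_adjoint S) (op_adjoint T).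
Proof.
move=> S0 T0; apply/seteqP; split=> [[x y] adj|[x y] [adj1 adj2] [u z] [Sq Tq]].
  split=> -[u z] uz /=.
    have := adj ((u, 0) : H2, (z, 0) : H2) (conj uz T0).
    by rewrite -[LHS]/(hdot _ _ + hdot _ _) -[RHS]/(hdot _ _ + hdot _ _) /= !hdot0l !addr0.
  have := adj ((0, u) : H2, (0, z) : H2) (conj S0 uz).
  by rewrite -[LHS]/(hdot _ _ + hdot _ _) -[RHS]/(hdot _ _ + hdot _ _) /= !hdot0l !add0r.
by rewrite -[LHS]/(hdot _ _ + hdot _ _) (adj1 _ Sq) (adj2 _ Tq).
Qed.

Lemma diag_op_positive S T : positive_op S -> positive_op T ->
  positive_op (diag_op S T : set (H2 * H2)).
Proof. by move=> Sp Tp p [/Sp Sq /Tp Tq]; exact: addr_ge0. Qed.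

Lemma denseP (H : hilbertType R[i]) (A : set H) :
  dense A <-> forall x (e : R), 0 < e -> exists2 y, A y & rnorm (x - y) <= e.
Proof.
split=> [dA x e e0|dA O [x Ox] oO].
  have e0C : 0 < e%:C%C by rewrite ltcR.
  have [|y [xy Ay]] := dA (ball x e%:C%C) _ (ball_open _ _).
    by exists x; exact: ballxx.
  exists y => //; move: xy; rewrite -ball_normE /= => /ltW.
  by rewrite -rnorm_le.
have /nbhs_ballP[e /gtc0P[r r0 ->] xO] : nbhs x O by exact: open_nbhs_nbhs.
have [|y Ay xy] := dA x (r / 2); first by rewrite divr_gt0.
exists y; split=> //; apply: xO; rewrite -ball_normE /= rnormE ltcR.
by apply: le_lt_trans xy _; lra.
Qed.

Lemma hsum_rnorm_leD (x : H2) : rnorm x <= rnorm x.1 + rnorm x.2.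
Proof. by rewrite -lecR rmorphD /= -!rnormE; exact: hsum_norm_le. Qed.

Lemma diag_op_dense S T : dense (op_dom S) -> dense (op_dom T) ->
  dense (op_dom (diag_op S T : set (H2 * H2))).
Proof.
move=> /denseP dS /denseP dT; apply/denseP => x e e0.
have e20 : 0 < e / 2 by rewrite divr_gt0.
have [y1 [z1 Sy1] xy1] := dS x.1 _ e20; have [y2 [z2 Ty2] xy2] := dT x.2 _ e20.
exists ((y1, y2) : H2); first by exists ((z1, z2) : H2).
by apply: le_trans (hsum_rnorm_leD _) _; rewrite [e]splitr lerD.
Qed.

Lemma diag_op_selfadjoint S T : selfadjoint S -> selfadjoint T ->
  selfadjoint (diag_op S T : set (H2 * H2)).
Proof.
move=> [So Sd Sa] [To Td Ta]; split.
- exact: diag_op_operator.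
- exact: diag_op_dense.
- by rewrite diag_op_adjoint ?Sa ?Ta//; [case: So|case: To].
Qed.

End DiagonalOperators.

Lemma selfadjoint_is_abs (R : realType) (H : hilbertType R[i]) (D : set (H * H)) :
  selfadjoint D -> positive_op D -> is_abs_op D D.
Proof. by move=> Ds Dp; split=> //; case: Ds => _ _ ->. Qed.

Section MultiplicationOperators.
Variables (R : realType) (L : zmodType) (g : L -> R).
Local Notation E2 := (ell2 R L).
Local Notation H2 := (hsum E2 E2).
Implicit Types b d : E2.

Lemma mul_op_operator : is_operator (mul_op g).
Proof.
split=> [l|a x y x' y' xy xy' l|x y y' xy xy'] /=.
- by rewrite mulr0.
- by rewrite -[LHS]/(a * y l + y' l) -[X in _ = _ * X]/(a * x l + x' l)
    (xy l) (xy' l) /=; ring.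
by apply: ell2_inj => l; rewrite (xy l) (xy' l).
Qed.

Lemma mul_op_delta p : mul_op g (delta R p, (g p)%:C%C *: delta R p).
Proof.
move=> l; rewrite -[LHS]/((g p)%:C%C * delta R p l) -[X in _ = _ * X]/(delta R p l).
by rewrite deltaE; case: eqP => [->//|_]; rewrite !mulr0.
Qed.

Lemma mul_op_dense : dense (op_dom (mul_op g)).
Proof.
apply/denseP => b e /(ell2_trunc_approx b)[A HA]; exists (ell2_trunc A b) => //.
exists (\sum_(p <- A) ((g p)%:C%C * b p) *: delta R p) => l.
rewrite !ell2_sumE mulr_sumr; apply: eq_bigr => p _.
by rewrite !ell2_scaleE deltaE; case: eqP => [->|_]; rewrite ?mulr0 ?mulrA.
Qed.

Lemma conjC_realC (r : R) : (r%:C%C)^* = r%:C%C :> R[i].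
Proof. exact: conjc_real. Qed.

Lemma mul_op_selfadjoint : selfadjoint (mul_op g).
Proof.
split; [exact: mul_op_operator|exact: mul_op_dense|].
apply/seteqP; split=> [[x y] adj l /=|[x y] xy [u z] uz].
  have := adj _ (mul_op_delta l); rewrite /= hdotZl !(hdotC _ (delta R l)) !hdot_delta.
  by move=> /(congr1 (fun t : R[i] => t^*)); rewrite rmorphM /= !conjCK conjC_realC => ->.
rewrite /= !hdot_ell2E /ell2_dot; apply: eq_sum => l.
by rewrite (uz l) (xy l) /= rmorphM /= conjC_realC; ring.
Qed.

Lemma sum_ge0 (u : L -> R[i]) (l : R[i]^o) : (forall m, 0 <= u m) ->
  summability.partial_sum (u : L -> R[i]^o) @ summability.totally --> l -> 0 <= (l : R[i]).
Proof.
move=> u0 /cvgrPdist_le ul.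
have near_s (e : R) : 0 < e -> exists2 s : R[i], 0 <= s & cabs ((l : R[i]) - s) <= e.
  rewrite -ltcR => /ul /filter_ex[A]; rewrite partial_sumE.
  rewrite -[X in X <= _]/(`|(l : R[i]) - _|) cabsE lecR => HA.
  by eexists; [|exact: HA]; exact: sumr_ge0.
rewrite lecE; apply/andP; split.
  suff : `|complex.Im (l : R[i])| <= 0 by rewrite normr_le0.
  apply: (@le0_eps _ _ 1) => e /near_s[s s0 ls]; rewrite mul1r.
  apply: le_trans ls; apply: le_trans (Im_le_cabs _).
  by case: s s0 => a b; rewrite lecE /= => /andP[/eqP-> _]; case: (l) => ? ? /=; rewrite subr0.
rewrite -oppr_le0; apply: (@le0_eps _ _ 1) => e /near_s[s s0 ls]; rewrite mul1r.
apply: le_trans ls; apply: le_trans (Re_le_cabs _).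
case: s s0 => a b; rewrite lecE /= => /andP[_ a0]; case: (l) => x y /=.
by have := ler_norm (- (x - a)); rewrite normrN; apply: le_trans; lra.
Qed.

Lemma hdot_ge0 b d : (forall l, 0 <= g l) -> (forall l, d l = (g l)%:C%C * b l) ->
  0 <= hdot d b.
Proof.
move=> g0 db; apply: sum_ge0 (@ell2_dot_cvg R L d b) => l.
by rewrite db -mulrA mulr_ge0 ?ler0c// -normCK exprn_ge0.
Qed.

Lemma mul_op_positive : (forall l, 0 <= g l) -> positive_op (mul_op g).
Proof. by move=> g0 [x y] xy; exact: hdot_ge0. Qed.

End MultiplicationOperators.

Section CommutatorKernels.
Variables (R : realType) (L : zmodType) (g : L -> R) (h : L -> R).
Hypothesis g_diff : forall l m, `|g l - g (l - m)| <= h m.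
Local Notation E2 := (ell2 R L).
Local Notation H2 := (hsum E2 E2).
Local Notation D := (diag_op (mul_op g) (mul_op g) : set (H2 * H2)).
Implicit Types k : L -> L -> R[i].

Definition commutator_kernel k l m : R[i] := (g l - g (l - m))%:C%C * k l m.

Lemma commutator_kernel_le k (w : L -> R) : (forall l m, cabs (k l m) <= w m) ->
  forall l m, cabs (commutator_kernel k l m) <= h m * w m.
Proof.
move=> kw l m; rewrite cabsM ler_pM ?cabs_ge0//.
by rewrite /cabs normc_def /= expr0n addr0 sqrtr_sqr.
Qed.

Lemma commutator_kop_val k w (W : R) w' (W' : R) b d : dominated k w W ->
  dominated (commutator_kernel k) w' W' -> mul_op g (b, d) ->
  mul_op g (kop k b, kop (commutator_kernel k) b + kop k d).
Proof. by move=> kw kw' bd l; exact/esym/(kop_mul kw kw' bd). Qed.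

Lemma kop_preserves_dom k w (W : R) w' (W' : R) : dominated k w W ->
  dominated (commutator_kernel k) w' W' -> preserves_dom D (diag_rep (kop k)).
Proof.
move=> kw kw' x [y [xy1 xy2]].
have H := commutator_kop_val kw kw'.
by exists ((kop (commutator_kernel k) x.1 + kop k y.1,
            kop (commutator_kernel k) x.2 + kop k y.2) : H2); split; exact: H.
Qed.

Lemma kop_commutator k w (W : R) w' (W' : R) : dominated k w W ->
  dominated (commutator_kernel k) w' W' ->
  bounded_extension (commutator D (diag_rep (kop k)))
    (diag_rep (kop (commutator_kernel k))).
Proof.
move=> kw kw'; split; first by apply: diag_rep_bounded; exact: kop_bounded kw'.
move=> [x c] [y [z [[xy1 xy2] [xz1 xz2] /= ->]]].
have [_ _ uniq] := mul_op_operator g.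
have H := commutator_kop_val kw kw'.
rewrite /op_graph /= /diag_rep /=.
have -> : z = ((kop (commutator_kernel k) x.1 + kop k y.1,
            kop (commutator_kernel k) x.2 + kop k y.2) : H2).
  rewrite [z]surjective_pairing.
  by rewrite (uniq _ _ _ xz1 (H _ _ xy1)) (uniq _ _ _ xz2 (H _ _ xy2)).
by rewrite [LHS]/GRing.add /= /add_pair /= !addrK.
Qed.

Lemma dom_ad_kop n k (w : L -> R) : (forall l m, cabs (k l m) <= w m) ->
  (forall j, (j <= n)%N -> exists W : R, forall A : {fset L},
    \sum_(m <- A) h m ^+ j * w m <= W) ->
  dom_ad D n (diag_rep (kop k)).
Proof.
elim: n k w => [|n IH] k w kw wW; have [W kW] := wW 0 (leq0n _).
  apply: diag_rep_bounded; apply: (@kop_bounded _ _ _ w W); split=> // A.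
  by have := kW A; under eq_bigr do rewrite expr0 mul1r.
have kd : dominated k w W.
  by split=> // A; have := kW A; under eq_bigr do rewrite expr0 mul1r.
have [W' kW'] := wW 1 isT.
have kd' : dominated (commutator_kernel k) (fun m => h m * w m) W'.
  split; first exact: commutator_kernel_le.
  by move=> A; have := kW' A; under eq_bigr do rewrite expr1.
split; first by apply: diag_rep_bounded; exact: kop_bounded kd.
  exact: kop_preserves_dom kd kd'.
exists (diag_rep (kop (commutator_kernel k))); first exact: kop_commutator kd kd'.
apply: IH (commutator_kernel_le kw) _ => j jn.
have [V HV] := wW j.+1 jn; exists V => A.
by have := HV A; under eq_bigr do rewrite exprSr -mulrA.
Qed.

End CommutatorKernels.

Section BoundedMultipliers.
Variables (R : realType) (L : zmodType).
Local Notation E2 := (ell2 R L).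
Implicit Types (s : L -> R) (b : E2).

Definition mulb s b : E2 := insubd (0 : E2) (fun l => (s l)%:C%C * b l : R[i]^o).

Lemma cabs_realM (r : R) (z : R[i]) : cabs (r%:C%C * z) = `|r| * cabs z.
Proof. by rewrite cabsM /cabs normc_def /= expr0n addr0 sqrtr_sqr. Qed.

Lemma mulbE s b l : (forall m, `|s m| <= 1) -> mulb s b l = (s l)%:C%C * b l.
Proof.
move=> s1; rewrite /mulb [ell2_val _]insubdK//.
apply: (@ell2_domP _ _ _ b 1) => m.
by rewrite cabs_realM ler_wpM2r ?cabs_ge0.
Qed.

Lemma mulb_bounded s : (forall l, `|s l| <= 1) -> bounded_op (mulb s).
Proof.
move=> s1; apply/bounded_opP; split.
  move=> a x y; apply: ell2_inj => l.
  by rewrite ell2_addE ell2_scaleE !mulbE// ell2_addE ell2_scaleE; ring.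
exists 1 => // b; apply: ell2_dom_norm => // l.
by rewrite mulbE// cabs_realM ler_wpM2r ?cabs_ge0.
Qed.

End BoundedMultipliers.

Section InverseSquareRoot.
Variables (R : realType) (L : zmodType) (g : L -> R).
Local Notation E2 := (ell2 R L).
Local Notation H2 := (hsum E2 E2).
Local Notation D := (diag_op (mul_op g) (mul_op g) : set (H2 * H2)).

Definition inv_sqrt_1D2 l := (Num.sqrt (1 + g l ^+ 2))^-1.
Local Notation s := inv_sqrt_1D2.

Let q_ge1 l : 1 <= 1 + g l ^+ 2.
Proof. by rewrite lerDl sqr_ge0. Qed.

Let q_gt0 l : 0 < 1 + g l ^+ 2.
Proof. exact: lt_le_trans (q_ge1 l). Qed.

Lemma inv_sqrt_1D2_ge0 l : 0 <= s l.
Proof. by rewrite invr_ge0 sqrtr_ge0. Qed.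

Lemma inv_sqrt_1D2_sqr l : (1 + g l ^+ 2) * s l ^+ 2 = 1.
Proof. by rewrite exprVn sqr_sqrtr ?mulfV ?gt_eqF// ltW. Qed.

Lemma inv_sqrt_1D2_le1 l : `|s l| <= 1.
Proof.
rewrite ger0_norm ?inv_sqrt_1D2_ge0// -(@ler_pXn2r _ 2)// ?nnegrE ?inv_sqrt_1D2_ge0//.
by rewrite expr1n -(inv_sqrt_1D2_sqr l) ler_peMl ?sqr_ge0.
Qed.

Lemma mulb_inv_sqrt_sqr (b d : E2) : d = mulb s (mulb s b) <->
  exists2 z, op_comp (mul_op g) (mul_op g) (d, z) & b = d + z.
Proof.
have s1 := inv_sqrt_1D2_le1.
have r1 l : `|g l * s l ^+ 2| <= 1.
  have := inv_sqrt_1D2_sqr l; have := sqr_ge0 (s l).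
  move: (s l ^+ 2) => t t0 gt; rewrite -(@ler_pXn2r _ 2)// ?nnegrE// real_normK ?num_real//.
  have p0 := sqr_ge0 (g l); rewrite mulrDl mul1r in gt.
  have -> : (g l * t) ^+ 2 = (g l ^+ 2 * t) * t by ring.
  have := mulr_ge0 p0 t0; rewrite expr1n => pt0; rewrite mulr_ile1//.
    by move: gt; move: (g l ^+ 2 * t) => y; lra.
  by move: gt pt0; move: (g l ^+ 2 * t) => y; lra.
have r2 l : `|g l ^+ 2 * s l ^+ 2| <= 1.
  have := inv_sqrt_1D2_sqr l; have := sqr_ge0 (s l); have := sqr_ge0 (g l) => g0 s0.
  rewrite ger0_norm ?(mulr_ge0 g0 s0)//; move: (s l ^+ 2) s0 => t t0.
  by rewrite mulrDl mul1r; move: (g l ^+ 2 * t) => y; lra.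
split=> [->|[z [y dy yz] E]].
  exists (mulb (fun l => g l ^+ 2 * s l ^+ 2) b).
    exists (mulb (fun l => g l * s l ^+ 2) b) => l.
      rewrite -[LHS]/(mulb _ b l) -[X in _ = _ * X]/(mulb s (mulb s b) l).
      by rewrite !mulbE// !rmorphM /=; ring.
    rewrite -[LHS]/(mulb _ b l) -[X in _ = _ * X]/(mulb _ b l).
    by rewrite !mulbE// !rmorphM /=; ring.
  apply: ell2_inj => l; rewrite ell2_addE !mulbE// mulrA -rmorphM -mulrDl -rmorphD /=.
  rewrite (_ : s l * s l + _ = 1) ?mul1r// -[RHS](inv_sqrt_1D2_sqr l).
  by ring.
apply: ell2_inj => l; rewrite !mulbE// E ell2_addE (yz l) /= (dy l) /=.
transitivity (((1 + g l ^+ 2) * s l ^+ 2)%:C%C * d l).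
  by rewrite inv_sqrt_1D2_sqr mul1r.
by rewrite !(rmorphM, rmorphD, rmorphXn, rmorph1) /=; ring.
Qed.

Lemma inv_sqrt_1D2P : is_inv_sqrt_1D2 D (diag_rep (mulb s)).
Proof.
have s1 := inv_sqrt_1D2_le1; have s0 := inv_sqrt_1D2_ge0.
split.
- exact: diag_rep_bounded (mulb_bounded s1).
- move=> [x y] E; have {E}-> : y = diag_rep (mulb s) x by [].
  apply: addr_ge0; apply: (hdot_ge0 s0) => l; exact: mulbE.
apply/seteqP; split=> [[x y] E|[x y] /= [z [u [yu1 yu2] [uz1 uz2]] xE]].
  have {E}-> : y = diag_rep (mulb s) (diag_rep (mulb s) x) by [].
  have [z1 [u1 xu1 uz1] x1] := (mulb_inv_sqrt_sqr x.1 _).1 erefl.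
  have [z2 [u2 xu2 uz2] x2] := (mulb_inv_sqrt_sqr x.2 _).1 erefl.
  exists ((z1, z2) : H2).
    exists ((u1, u2) : H2); split; [exact: xu1|exact: xu2|exact: uz1|exact: uz2].
  by rewrite [x in LHS]surjective_pairing x1 x2.
rewrite [y]surjective_pairing; congr (_, _); apply/mulb_inv_sqrt_sqr.
  by exists z.1; [exists u.1|rewrite xE].
by exists z.2; [exists u.2|rewrite xE].
Qed.

End InverseSquareRoot.

Section Ultrafilters.
Variables (R : realType) (T : Type) (F : set_system T).
Context {FU : UltraFilter F}.

Lemma ultra_bounded_cvg (u : T -> R) (M : R) : F [set t | `|u t| <= M] ->
  exists x : R, u @ F --> x.
Proof.
move=> uM; have [|x [_ xc]] := @segment_compact R (- M) M (u @ F) _.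
  by apply: (@filterS _ F _ _ (u @^-1` _) _ uM) => t /=; rewrite in_itv /= ler_norml.
exists x => U xU.
have [//|Fn] := in_ultra_setVsetC (u @^-1` U) FU.
have [y [Uny Uy]] := xc (~` U) U Fn xU.
by [].
Qed.

Lemma ultra_bounded_cvgC (u : T -> R[i]^o) (M : R) : F [set t | cabs (u t) <= M] ->
  exists x : R[i]^o, u @ F --> x.
Proof.
move=> uM.
have [x ux] : exists x : R, (fun t => complex.Re (u t)) @ F --> x.
  by apply: (@ultra_bounded_cvg _ M); apply: (filterS _ uM) => t /=; apply: le_trans (Re_le_cabs _).
have [y uy] : exists y : R, (fun t => complex.Im (u t)) @ F --> y.
  by apply: (@ultra_bounded_cvg _ M); apply: (filterS _ uM) => t /=; apply: le_trans (Im_le_cabs _).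
by exists (x +i* y)%C; exact: cvg_complex.
Qed.

End Ultrafilters.

Section CompactEllipsoid.
Variables (R : realType) (L : zmodType) (q : L -> R).
Hypothesis q_ge1 : forall l, 1 <= q l.
Hypothesis q_coercive : forall M : R, exists A : {fset L}, forall l, l \notin A -> M <= q l.
Local Notation E2 := (ell2 R L).

Definition ellipsoid : set E2 :=
  [set b | forall A : {fset L}, \sum_(l <- A) q l * cabs (b l) ^+ 2 <= 1].

Let q_ge0 l : 0 <= q l.
Proof. exact: le_trans ler01 (q_ge1 l). Qed.

Lemma ellipsoid_coord b l : ellipsoid b -> cabs (b l) <= 1.
Proof.
move=> /(_ [fset l]%fset); rewrite big_seq_fset1 => bl.
rewrite -(@ler_pXn2r _ 2)// ?nnegrE ?cabs_ge0// expr1n; apply: le_trans bl.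
by rewrite ler_peMl ?sqr_ge0.
Qed.

Lemma ellipsoid_sub b d (A : {fset L}) : ellipsoid b -> ellipsoid d ->
  \sum_(l <- A) q l * cabs ((b - d) l) ^+ 2 <= 4.
Proof.
move=> bQ dQ.
apply: (@le_trans _ _ (\sum_(l <- A)
    (2 * (q l * cabs (b l) ^+ 2) + 2 * (q l * cabs (d l) ^+ 2)))).
  apply: ler_sum => l _; rewrite !(mulrCA 2) -mulrDr ler_wpM2l//.
  have : cabs ((b - d) l) <= cabs (b l) + cabs (d l).
    by apply: le_trans (cabsD _ _) _; rewrite cabsN.
  move: (cabs_ge0 ((b - d) l)) (cabs_ge0 (b l)) (cabs_ge0 (d l)).
  move: (cabs ((b - d) l)) (cabs (b l)) (cabs (d l)) => z x y z0 x0 y0 zxy.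
  apply: (@le_trans _ _ ((x + y) ^+ 2)); first by rewrite ler_pXn2r// nnegrE addr_ge0.
  rewrite -subr_ge0 (_ : _ - _ = (x - y) ^+ 2) ?sqr_ge0//; ring.
rewrite big_split -!mulr_sumr /=; have := bQ A; have := dQ A; lra.
Qed.

(* Coordinatewise limits are norm limits on the ellipsoid: outside a finite set the
   coordinates are uniformly square-summably small. *)
Lemma ellipsoid_ultra (T : Type) (F : set_system T) (phi : T -> E2) :
  UltraFilter F -> F (phi @^-1` ellipsoid) ->
  exists2 b, ellipsoid b & phi @ F --> b.
Proof.
move=> FU FQ.
have /choice[x phix] : forall l, exists x : R[i]^o, (fun t => phi t l) @ F --> x.
  move=> l; apply: (@ultra_bounded_cvgC _ _ _ _ _ 1).
  by apply: (filterS _ FQ) => t tQ; exact: ellipsoid_coord tQ.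
have xQ (A : {fset L}) : \sum_(l <- A) q l * cabs (x l) ^+ 2 <= 1.
  have H : (fun t => \sum_(l <- A) q l * cabs (phi t l) ^+ 2) @ F
      --> \sum_(l <- A) q l * cabs (x l) ^+ 2.
    exact: (@cvg_cabs_sum _ _ F _ _ A (fun l t => phi t l) x q 2).
  by apply: (cvgr_to_le H); apply: (filterS _ FQ) => t; apply.
have xP : x \in @ell2_pred R L.
  apply: (@ell2_predP _ _ _ 1) => A; apply: le_trans (xQ A).
  by apply: ler_sum => l _; rewrite ler_peMl ?sqr_ge0.
exists (Ell2 xP) => //; set b := Ell2 xP.
have bQ : ellipsoid b by exact: xQ.
apply/cvgrPdist_le => e /gtc0P[r r0 ->].
have [A HA] := q_coercive (8 / r ^+ 2).
have H : (fun t => \sum_(l <- A) 1 * cabs ((b - phi t) l) ^+ 2) @ F --> (0 : R).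
  have dl l : (fun t => (b - phi t) l) @ F --> (0 : R[i]^o).
    rewrite -[X in _ --> X](subrr (x l)).
    exact: (@cvgB _ R[i]^o _ F _ (fun=> x l) (fun t => phi t l) _ _ (cvg_cst _) (phix l)).
  have E0 : \sum_(l <- A) 1 * cabs (0 : R[i]) ^+ 2 = 0.
    by rewrite big1// => l _; rewrite /cabs normr0 expr0n mulr0.
  have := @cvg_cabs_sum R T F _ L A (fun l t => (b - phi t) l) (fun=> 0) (fun=> 1) 2 dl.
  by rewrite E0; apply.
have r22 : 0 < r ^+ 2 / 2 by rewrite divr_gt0// exprn_gt0.
move/cvgrPdist_le: H => /(_ _ r22) H.
near=> t; rewrite -rnorm_le; apply: ell2_norm_le => [|B]; first exact: ltW.
have tQ : ellipsoid (phi t) by near: t.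
have sA : \sum_(l <- A) 1 * cabs ((b - phi t) l) ^+ 2 <= r ^+ 2 / 2.
  have : `|0 - \sum_(l <- A) 1 * cabs ((b - phi t) l) ^+ 2| <= r ^+ 2 / 2 by near: t.
  by rewrite sub0r normrN; apply: le_trans; exact: ler_norm.
have r2gt0 : 0 < r ^+ 2 by rewrite exprn_gt0.
apply: (@le_trans _ _ (\sum_(l <- (A `|` B)%fset) cabs ((b - phi t) l) ^+ 2)).
  by apply: ler_sum_fsubset (fsubsetUr A B) => l; rewrite sqr_ge0.
rewrite (bigID (mem A)) /= [leRHS]splitr lerD//.
  rewrite sum_fsetU_mem; under eq_bigr do rewrite -[_ ^+ 2]mul1r.
  exact: sA.
apply: (@le_trans _ _ (r ^+ 2 / 8 * \sum_(l <- (A `|` B)%fset) q l * cabs ((b - phi t) l) ^+ 2)).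
  rewrite mulr_sumr big_mkcond; apply: ler_sum => l _.
  case: ifPn => [lA|_]; last first.
    by apply: mulr_ge0; [rewrite divr_ge0// ltW|rewrite mulr_ge0 ?sqr_ge0].
  rewrite mulrA ler_peMl ?sqr_ge0//; have := HA _ lA.
  rewrite ler_pdivrMr// => ?; rewrite mulrAC ler_pdivlMr// mul1r mulrC; exact: le_trans.
apply: (@le_trans _ _ (r ^+ 2 / 8 * 4)); last lra.
by apply: ler_wpM2l; [rewrite divr_ge0// ltW|exact: ellipsoid_sub].
Unshelve. all: by end_near. Qed.

Lemma ellipsoid_sum_compact :
  compact [set x : hsum E2 E2 | ellipsoid x.1 /\ ellipsoid x.2].
Proof.
rewrite compact_ultra => F FU FQ.
have [b1 b1Q /cvgrPdist_lt F1] : exists2 b, ellipsoid b & (fun x : hsum E2 E2 => x.1) @ F --> b.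
  by apply: ellipsoid_ultra; apply: (filterS _ FQ) => x [].
have [b2 b2Q /cvgrPdist_lt F2] : exists2 b, ellipsoid b & (fun x : hsum E2 E2 => x.2) @ F --> b.
  by apply: ellipsoid_ultra; apply: (filterS _ FQ) => x [].
exists ((b1, b2) : hsum E2 E2); split=> //.
apply/cvgrPdist_lt => e e0; have e20 : 0 < e / 2 by rewrite divr_gt0.
have {}F1 := F1 _ e20; have {}F2 := F2 _ e20.
near=> x; apply: le_lt_trans (hsum_norm_le _) _; rewrite [e]splitr ltrD//=.
  by near: x.
by near: x.
Unshelve. all: by end_near. Qed.

End CompactEllipsoid.

Lemma bounded_op_continuous (R : realType) (H : hilbertType R[i]) (T : H -> H) :
  bounded_op T -> continuous T.
Proof.
move=> /bounded_opP[Tl [M M0 TM]] x; apply/cvgrPdist_le => e /gtc0P[r r0 ->].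
have M1 : 0 < M + 1 by lra.
have /cvgrPdist_le/(_ (r / (M + 1))%:C%C) := @cvg_id _ (nbhs x).
rewrite ltcR divr_gt0// => /(_ isT); apply: filterS => y /=.
rewrite -!rnorm_le => xy; rewrite -(linear_sub _ _ Tl); apply: le_trans (TM _) _.
apply: le_trans (ler_wpM2l M0 xy) _.
by rewrite mulrCA ler_piMr ?(ltW r0)// ler_pdivrMr// mul1r lerDl.
Qed.

Section CompactResolvent.
Variables (R : realType) (L : zmodType) (g : L -> R).
Hypothesis g_coercive : forall M : R, finite_set [set l | g l <= M].
Local Notation E2 := (ell2 R L).

Lemma compact_mul_inv_sqrt (T : hsum E2 E2 -> hsum E2 E2) : bounded_op T ->
  compact_op (T \o diag_rep (mulb (inv_sqrt_1D2 g))).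
Proof.
move=> Tb; have s1 := @inv_sqrt_1D2_le1 R L g.
split; first by apply: bounded_comp => //; exact: diag_rep_bounded (mulb_bounded s1).
pose q l := 1 + g l ^+ 2.
have q1 l : 1 <= q l by rewrite lerDl sqr_ge0.
have qc (M : R) : exists A : {fset L}, forall l, l \notin A -> M <= q l.
  have /finite_fsetP[A AE] := g_coercive `|M|.
  exists A => l lA; have : ~ (g l <= `|M|).
    move=> gl; have : [set` A] l by rewrite -AE.
    by rewrite /= (negPf lA).
  move/negP; rewrite -ltNge /q => Mg; apply: le_trans (ler_norm M) _.
  by have := normr_ge0 M; nra.
have KC := ellipsoid_sum_compact q1 qc.
have TC : compact (T @` [set x : hsum E2 E2 | ellipsoid q x.1 /\ ellipsoid q x.2]).
  apply: continuous_compact => //; apply: continuous_subspaceT.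
  exact: bounded_op_continuous.
apply: precompact_subset (compact_precompact (@norm_hausdorff _ _) TC).
move=> _ [x x1 <-] /=; exists (diag_rep (mulb (inv_sqrt_1D2 g)) x) => //.
have sQ (b : E2) : rnorm b <= 1 -> ellipsoid q (mulb (inv_sqrt_1D2 g) b).
  move=> b1 A.
  have E l : q l * cabs (mulb (inv_sqrt_1D2 g) b l) ^+ 2 = cabs (b l) ^+ 2.
    rewrite mulbE// cabs_realM exprMn real_normK ?num_real// mulrA.
    by rewrite inv_sqrt_1D2_sqr mul1r.
  under eq_bigr do rewrite E; apply: le_trans (ell2_sum_le _ _) _.
  by rewrite expr_le1 ?rnorm_ge0.
have rx : rnorm x <= 1 by rewrite rnorm_le.
split; apply: sQ; apply: le_trans rx; rewrite -lecR -!rnormE.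
  exact: hsum_norm1.
exact: hsum_norm2.
Qed.

End CompactResolvent.

Section Weights.
Variables (R : realType) (G : topologicalZmodType) (v : phase_space R G -> R).
Hypothesis hv : weight v.

Lemma weight_ge1 x : 1 <= v x.
Proof.
have v0 : 1 <= v 0.
  have := weight_submul hv 0 0; rewrite addr0 -[leLHS]mulr1 ler_pM2l//.
  rewrite lt_def; apply/andP; split; first exact/eqP/(weight_neq0 hv).
  exact: (weight_ge0 hv).
have := weight_submul hv x (- x); rewrite subrr -(weight_sym hv) => vx.
have := le_trans v0 vx; rewrite -expr2 -[leLHS](expr1n _ 2).
by rewrite ler_pXn2r ?nnegrE ?ler01 ?(weight_ge0 hv).
Qed.

End Weights.

Section HeisenbergCocycle.
Variables (R : realType) (G : topologicalZmodType) (L : zmodClosed (phase_space R G)).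
Local Notation c := (@lattice_cocycle R G L).

Lemma lattice_cocycle_norm x y : `|c x y| = 1.
Proof. by rewrite /lattice_cocycle /heisenberg norm_conjC dual_norm. Qed.

Lemma lattice_cocycleDl x y z : c (x + y) z = c x z * c y z.
Proof. by rewrite /lattice_cocycle /heisenberg -rmorphM -dualD. Qed.

Lemma lattice_cocycleDr x y z : c z (x + y) = c z x * c z y.
Proof. by rewrite /lattice_cocycle /heisenberg -rmorphM. Qed.

End HeisenbergCocycle.

Section SpectralTriple.
Variables (R : realType) (G : topologicalZmodType).
Variables (v : phase_space R G -> R) (L : zmodClosed (phase_space R G)) (f : R -> R).
Hypothesis hv : weight v.
Hypothesis hf : spectral_compatible f v L.
Local Notation E := (subgroup_elt L).
Local Notation c := (@lattice_cocycle R G L).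
Local Notation g := (fun l : E => f (v (elt_val l))).
Local Notation D := (@dirac_op R G L f v).

Lemma compatible_fv_ge0 (l : E) : 0 <= g l.
Proof. by apply: (compatible_ge0 hf); exact: (weight_ge0 hv). Qed.

Lemma pow_weight_ge0 n (l : E) : 0 <= v (elt_val l) ^+ n.
Proof. by rewrite exprn_ge0// (weight_ge0 hv). Qed.

Lemma pow_weightM n (l m : E) :
  v (elt_val (l + m)) ^+ n <= v (elt_val l) ^+ n * v (elt_val m) ^+ n.
Proof.
rewrite -exprMn lerXn2r// ?nnegrE ?mulr_ge0 ?(weight_ge0 hv)//.
exact: (weight_submul hv).
Qed.

Lemma pow_weightN n (l : E) : v (elt_val (- l)) ^+ n = v (elt_val l) ^+ n.
Proof. by rewrite -[elt_val (- l)]/(- elt_val l) -(weight_sym hv). Qed.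

Lemma compatible_diff : exists h : E -> R, exists2 C : R, 0 <= C &
  (forall l m, `|g l - g (l - m)| <= h m) /\ forall m, h m <= C * v (elt_val m).
Proof.
have [C C0 HC] := compatible_dif hf; have [B B0 HB] := compatible_gr hf.
exists (fun m => C * g m); exists (C * B); first by rewrite mulr_ge0.
split=> [l m|m]; last by rewrite -mulrA ler_wpM2l// HB// elt_valP.
have := HC (elt_val (l - m)) (elt_val m) (elt_valP _) (elt_valP _).
by rewrite -[elt_val (l - m) + elt_val m]/(elt_val (l - m + m)) subrK.
Qed.

Lemma dirac_selfadjoint : selfadjoint D.
Proof. by apply: diag_op_selfadjoint; exact: mul_op_selfadjoint. Qed.

Lemma dirac_positive : positive_op D.
Proof. by apply: diag_op_positive; apply: mul_op_positive; exact: compatible_fv_ge0. Qed.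

Lemma ell1_algebra_moments n (a : E -> R[i]) (h : E -> R) (C : R) :
  ell1_algebra v n a -> (forall m, 0 <= h m) -> 0 <= C ->
  (forall m, h m <= C * v (elt_val m)) ->
  forall j, (j <= n)%N -> exists W : R, forall A : {fset E},
    \sum_(m <- A) h m ^+ j * cabs (a m) <= W.
Proof.
move=> /(ell1wP _ (pow_weight_ge0 n))[_ [M aM]] h0 C0 hC j jn.
exists (C ^+ j * M) => A.
apply: (@le_trans _ _ (C ^+ j * \sum_(m <- A) cabs (a m) * v (elt_val m) ^+ n)).
  rewrite mulr_sumr; apply: ler_sum => m _.
  rewrite [cabs _ * _]mulrC mulrA ler_wpM2r ?cabs_ge0//.
  apply: (@le_trans _ _ (C ^+ j * v (elt_val m) ^+ j)).
    by rewrite -exprMn lerXn2r ?nnegrE ?h0 ?mulr_ge0 ?(weight_ge0 hv).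
  by rewrite ler_wpM2l ?exprn_ge0// ler_weXn2l// (weight_ge1 hv).
by rewrite ler_wpM2l ?exprn_ge0.
Qed.

Lemma ell1_ops_commutator n a : (1 <= n)%N -> ell1_algebra v n a ->
  exists k' : E -> E -> R[i], [/\ preserves_dom D (diag_rep (lconv c a)),
    bounded_extension (commutator D (diag_rep (lconv c a))) (diag_rep (kop k')) &
    forall k, (k + 1 <= n)%N -> dom_ad D k (diag_rep (lconv c a)) /\
      dom_ad D k (diag_rep (kop k'))].
Proof.
move=> n1 an; have [h [C C0 [gh hC]]] := compatible_diff.
have h0 m : 0 <= h m by apply: le_trans (gh 0 m).
have mom := ell1_algebra_moments an h0 C0 hC.
have kw l m : cabs (conv_kernel c a l m) <= cabs (a m).
  by rewrite (cabs_conv_kernel (@lattice_cocycle_norm R G L)).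
have [W kW] := mom 0 (leq0n _); have [W' kW'] := mom 1 n1.
have kd : dominated (conv_kernel c a) (fun m => cabs (a m)) W.
  by split=> // A; have := kW A; under eq_bigr do rewrite expr0 mul1r.
have kd' : dominated (commutator_kernel g (conv_kernel c a)) (fun m => h m * cabs (a m)) W'.
  split; first exact: commutator_kernel_le.
  by move=> A; have := kW' A; under eq_bigr do rewrite expr1.
exists (commutator_kernel g (conv_kernel c a)); rewrite lconvE; split.
- exact: kop_preserves_dom kd kd'.
- exact: kop_commutator kd kd'.
move=> k kn; split.
  apply: (dom_ad_kop gh kw) => j jk; apply: mom.
  by rewrite (leq_trans jk)// (leq_trans _ kn)// leq_addr.
apply: (dom_ad_kop gh (commutator_kernel_le gh kw)) => j jk.
have [|V HV] := mom j.+1; first by rewrite (leq_trans _ kn)// addn1.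
by exists V => A; have := HV A; under eq_bigr do rewrite exprSr -mulrA.
Qed.

Lemma ell1_star_embedding n : star_embedding c (ell1_algebra v n).
Proof.
apply: star_embedding_ell1w.
- exact: lattice_cocycle_norm.
- exact: lattice_cocycleDl.
- exact: lattice_cocycleDr.
- exact: pow_weight_ge0.
- exact: pow_weightM.
- exact: pow_weightN.
Qed.

Lemma ell1_spectral_datum n : (1 <= n)%N ->
  spectral_datum (twisted_cstar c) (@diag_rep R E) (@ell1_ops R G L v n) D.
Proof.
move=> n1.
have cA := twisted_cstar_algebra (@lattice_cocycle_norm R G L)
  (@lattice_cocycleDl R G L) (@lattice_cocycleDr R G L).
split.
- exact: cA.
- apply: twisted_cstar_dense.
  + exact: lattice_cocycle_norm.
  + exact: lattice_cocycleDl.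
  + exact: lattice_cocycleDr.
  + exact: pow_weight_ge0.
  + exact: pow_weightM.
  + exact: pow_weightN.
- by apply: diag_rep_star_representation; case: cA.
- exact: dirac_selfadjoint.
- by move=> _ [a an <-]; have [k' []] := ell1_ops_commutator n1 an.
- move=> _ [a an <-]; have [k' [_ ext _]] := ell1_ops_commutator n1 an.
  by exists (diag_rep (kop k')).
Qed.

Lemma ell1_spectral_triple n : (1 <= n)%N -> coercive L f v ->
  spectral_triple (twisted_cstar c) (@diag_rep R E) (@ell1_ops R G L v n) D.
Proof.
move=> n1 fv; split; first exact: ell1_spectral_datum.
exists (diag_rep (mulb (inv_sqrt_1D2 g))); first exact: inv_sqrt_1D2P.
move=> _ [a [a1 _] <-]; apply: compact_mul_inv_sqrt => //.
by apply: diag_rep_bounded; apply: lconv_bounded => //; exact: lattice_cocycle_norm.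
Qed.

Lemma ell1_quantum_C n k : (k + 1 <= n)%N ->
  quantum_C (@diag_rep R E) (@ell1_ops R G L v n) D k.
Proof.
move=> kn _ [a an <-]; have n1 : (1 <= n)%N by rewrite (leq_trans _ kn)// leq_addl.
have [k' [dom ext ad]] := ell1_ops_commutator n1 an.
have [ad1 ad2] := ad k kn.
exists D; exists (diag_rep (kop k')).
split; [|exact: dom|exact: ext|exact: ad1|exact: ad2].
exact: selfadjoint_is_abs dirac_selfadjoint dirac_positive.
Qed.

End SpectralTriple.

Theorem proposition5p12 (R : realType) (G : topologicalZmodType)
    (hausG : hausdorff_space G) (lcG : locally_compact [set: G])
    (scG : @second_countable G)
    (v : phase_space R G -> R) (hv : weight v)
    (L : zmodClosed (phase_space R G)) (hL : is_lattice L)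
    (f : R -> R) (hf : spectral_compatible f v L) :
  let c := @lattice_cocycle R G L in
  let A := twisted_cstar c in
  let rho := @diag_rep R (subgroup_elt L) in
  let D := @dirac_op R G L f v in
  [/\ forall n : nat, (1 <= n)%N ->
        star_embedding c (@ell1_algebra R G L v n) /\
        spectral_datum A rho (@ell1_ops R G L v n) D,
      forall n : nat, (1 <= n)%N -> coercive L f v ->
        spectral_triple A rho (@ell1_ops R G L v n) D,
      forall n k : nat, (k + 1 <= n)%N ->
        @ell1_ops R G L v n `<=` QC rho (@ell1_ops R G L v n) D k
    & forall n k : nat, (k + 1 <= n)%N ->
        quantum_C rho (@ell1_ops R G L v n) D k].
Proof.
move=> c A rho D; split.
- move=> n n1; split; first exact: ell1_star_embedding.
  exact: ell1_spectral_datum.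
- by move=> n n1; exact: ell1_spectral_triple.
- by move=> n k kn a an; split; [exact: an|exact: (ell1_quantum_C hv hf kn an)].
- by move=> n k kn; exact: ell1_quantum_C.
Qed.
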